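(* Let $d>2$, $\Omega\subseteq\mathbb{R}^d$ open, $2\le k\le d-1$ (no parity assumption on $k,d$), $p\ge1$. Let $f\in W^{1,p}(\Omega,\mathbb{R}^d)$ with either $\det df>0$ a.e. or $\det df<0$ a.e., suppose that $x\mapsto\bigwedge^kdf_x$ has a smooth representative taking values in $\operatorname{GL}(\bigwedge^k\mathbb{R}^d)$ everywhere, and suppose in addition that the weak derivatives of $f$ are continuous (have continuous representatives). Then $f$ is smooth.
   Context: $\bigwedge^kA$ is the endomorphism of $\bigwedge^k\mathbb{R}^d$ given by $v_1\wedge\dots\wedge v_k\mapsto Av_1\wedge\dots\wedge Av_k$. *)

(* Defs.v *)
From HB Require Import structures.
From mathcomp Require Import all_boot all_order all_algebra.
From mathcomp Require Import all_classical all_reals all_analysis.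
Set Implicit Arguments. Unset Strict Implicit. Unset Printing Implicit Defensive.
Import Order.TTheory GRing.Theory Num.Theory.
Import numFieldNormedType.Exports.
Local Open Scope classical_set_scope.
Local Open Scope ring_scope.

Section Defs.
Variables (R : realType) (d : nat).
Local Notation V := 'rV[R]_d.

Definition box (a b : V) : set V := [set x | forall i, a 0 i <= x 0 i <= b 0 i].

Definition vol (a b : V) : R := \prod_(i < d) Num.max (b 0 i - a 0 i) 0.

Definition lout (A : set V) : \bar R :=
  ereal_inf [set s : \bar R | exists a b : nat -> V,
     A `<=` \bigcup_n box (a n) (b n) /\
     s = (\sum_(0 <= n <oo) ((vol (a n) (b n))%:E))%E].

Definition lmeas (E : set V) : Prop :=
  forall A : set V, lout A = (lout (A `&` E) + lout (A `&` ~` E))%E.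

Definition ae_on (D : set V) (P : V -> Prop) : Prop :=
  lout [set x | D x /\ ~ P x] = 0%E.

Definition lmeasfun (D : set V) (u : V -> R) : Prop :=
  forall t : R, lmeas [set x | D x /\ t < u x].

(* Lebesgue integral over D of a nonnegative function (layer-cake formula) *)
Definition lint_nn (D : set V) (u : V -> R) : \bar R :=
  (\int[@lebesgue_measure R]_(t in `[0%R, +oo[%classic)
      lout [set x | D x /\ (t < u x)%R])%E.

Definition lint (D : set V) (u : V -> R) : R :=
  fine (lint_nn D (fun x => Num.max (u x) 0)) -
  fine (lint_nn D (fun x => Num.max (- u x) 0)).

Definition Lp (p : R) (D : set V) (u : V -> R) : Prop :=
  lmeasfun D u /\ (lint_nn D (fun x => powR `|u x| p) < +oo)%E.

Definition evec (i : 'I_d) : V := delta_mx 0 i.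

Definition partial (i : 'I_d) (g : V -> R) : V -> R :=
  fun x => 'D_(evec i) g x.

Definition ipartial (s : seq 'I_d) (g : V -> R) : V -> R :=
  foldr partial g s.

Definition smooth_on (D : set V) (g : V -> R) : Prop :=
  forall s : seq 'I_d, forall x, D x ->
    (forall i, derivable (ipartial s g) x (evec i)) /\
    {for x, continuous (ipartial s g)}.

Definition test_fun (D : set V) (phi : V -> R) : Prop :=
  smooth_on setT phi /\
  compact (closure [set x | phi x != 0]) /\
  closure [set x | phi x != 0] `<=` D.

(* Sobolev space W^{1,p}(D, R^d): f has components f_j = f x 0 j in L^p(D) and
   Df x j i is (a representative of) the weak derivative d_i f_j, in L^p(D). *)
Definition sobolev_jac (p : R) (D : set V) (f : V -> V) (Df : V -> 'M[R]_d)
  : Prop :=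
  (forall j : 'I_d, Lp p D (fun x => f x 0 j)) /\
  (forall j i : 'I_d, Lp p D (fun x => Df x j i)) /\
  (forall (j i : 'I_d) (phi : V -> R), test_fun D phi ->
     lint D (fun x => f x 0 j * partial i phi x) =
     - lint D (fun x => Df x j i * phi x)).

End Defs.

(* k-subsets of {0, ..., n-1}: they index the standard basis e_I of /\^k R^n *)
Definition ksub (n k : nat) := {S : {set 'I_n} | #|S| == k}.

(* the increasing enumeration 'I_k -> 'I_n of a k-subset *)
Definition kidx (n k : nat) (S : ksub n k) (a : 'I_k) : 'I_n :=
  enum_val (cast_ord (esym (eqP (valP S))) a).

(* matrix of /\^k A in the basis (e_I)_I:  entry (I, J) = det A[I, J] *)
Definition extpow (R : comRingType) (n k : nat) (A : 'M[R]_n)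
  : 'M[R]_#|{: ksub n k}| :=
  \matrix_(I, J) \det (\matrix_(a < k, b < k)
                         A (kidx (enum_val I) a) (kidx (enum_val J) b)).

(* Main.v *)
(* Let G be the continuous representative of df. For an invertible matrix A,
   A (1 + E_ij) A^-1 = 1 + (column i of A) (row j of A^-1); since A |-> /\^k A is
   multiplicative, each product A_pi (A^-1)_jq with p != q is, up to sign, an
   entry of (/\^k A) (/\^k (1 + E_ij)) (/\^k A)^-1. Taking A = G, these products
   are smooth. Choose j with (G^-1)_jq != 0 near a given point and a nonzero
   k-minor of G whose rows avoid q: multiplying the minor by (G^-1)_jq ^ k gives a
   polynomial in the smooth products, while the minor is an entry of the smooth
   /\^k G. So (G^-1)_jq ^ k is smooth, hence so is its continuous k-th root
   (G^-1)_jq, and dividing by it, so are the entries G_pi with p != q.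

   It remains to see that f agrees a.e. with a function of gradient G. Testing
   against bumps that tend to the indicator of a box, the mean of f over a cube
   changes under a translation by t e_i by t c, up to an error t eps as soon as
   |G_i - c| <= eps nearby. Hence the means over dyadic cubes converge locally
   uniformly, their limit has gradient G, and it has the same integral as f over
   every small box, so that it equals f a.e. by a Dynkin class argument. *)
Require Import Defs.
From HB Require Import structures.
From mathcomp Require Import all_boot all_order all_algebra fingroup perm.
From mathcomp Require Import all_classical all_reals all_analysis.
From mathcomp Require Import measurable_realfun ring lra.
Import Order.TTheory GRing.Theory Num.Theory.
Import numFieldNormedType.Exports.
Set Implicit Arguments. Unset Strict Implicit. Unset Printing Implicit Defensive.
Local Open Scope classical_set_scope.
Local Open Scope ring_scope.

(** * Lebesgue outer measure on R^d *)

(** For even [k] the matrices A and -A have the same exterior power, so /\^k alone cannot return an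
    entry with its sign: a k-th power is what it yields, and the continuity of G selects the root.
    Only pairs p != q are used because a minor of 1 + v w^T whose row and column sets differ by
    exchanging p for q is the single product v_p w_q, while a principal minor is 1 plus a sum of
    products. The bound k <= d - 1 leaves room both for this exchange and for a minor that avoids q.

    In the second half f is merely integrable, so it has no meaningful pointwise increments. They
    are replaced by increments of integrals over boxes: translating the test function instead of f
    allows differentiation under the integral sign, and the weak derivative enters there. Equality
    a.e. is likewise read off from integrals over boxes, without Lebesgue points.

    The integral is given by the layer-cake formula for an outer measure defined by box covers.
    Carathéodory's construction and Tonelli's theorem identify it with the integral of a genuine
    measure, for which dominated convergence is available. *)

Section outer_measure.
Variables (R : realType) (n : nat).
Local Notation d := n.+1.
Local Notation V := 'rV[R]_d.

Lemma vol_ge0 (a b : V) : 0 <= vol a b.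
Proof. by apply: prodr_ge0 => i _; rewrite le_max lexx orbT. Qed.

(** Positive dimension matters: for dimension 0 the empty product would be 1. Such point boxes pad
    finite covers to sequences. *)
Lemma vol0 : vol (0 : V) 0 = 0.
Proof. by rewrite /vol (bigD1 ord0) //= !mxE subrr maxxx mul0r. Qed.

Lemma volE (a b : V) : (forall i, a 0 i <= b 0 i) ->
  vol a b = \prod_(i < d) (b 0 i - a 0 i).
Proof. by move=> ab; apply: eq_bigr => i _; apply/max_idPl; rewrite subr_ge0. Qed.

Lemma lout_ge0 (A : set V) : (0 <= lout A)%E.
Proof.
apply: le_ereal_inf_tmp => _ [a [b [_ ->]]].
by apply: nneseries_ge0 => i _ _; rewrite lee_fin vol_ge0.
Qed.

Lemma le_lout : {homo @lout R d : A B / A `<=` B >-> (A <= B)%E}.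
Proof.
move=> A B AB; apply: ereal_inf_le_tmp => _ [a [b [Bab ->]]].
by exists a, b; split => //; exact: subset_trans Bab.
Qed.

Lemma lout_le_vol (a b : V) : (lout (box a b) <= (vol a b)%:E)%E.
Proof.
apply: ereal_inf_lbound.
exists (fun k => if k == 0%N then a else 0), (fun k => if k == 0%N then b else 0).
split; first by move=> x abx; exists 0%N.
rewrite nneseries_recl//=; last by move=> k _; rewrite lee_fin vol_ge0.
rewrite eseries_cond/= eseries0 ?adde0// => -[|k]//= _ _.
by rewrite vol0.
Qed.

Lemma lout0 : lout (set0 : set V) = 0%E.
Proof.
apply/eqP; rewrite eq_le lout_ge0 andbT.
by have := lout_le_vol (0 : V) 0; rewrite vol0; apply: le_trans; exact: le_lout.
Qed.

Lemma lout_adherent (A : set V) (e : R) : 0 < e -> lout A \is a fin_num ->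
  exists a b : nat -> V, A `<=` \bigcup_k box (a k) (b k) /\
   (\sum_(0 <= k <oo) ((vol (a k) (b k))%:E) <= lout A + e%:E)%E.
Proof.
move=> e0 fA; have [_ [a [b [Aab ->]]] /ltW h] := lb_ereal_inf_adherent e0 fA.
by exists a, b.
Qed.

(** Covers of the [A k] that are optimal up to e / 2^(k+1) are merged into one sequence along a
    bijection between [nat] and [nat * nat]. *)
Lemma lout_sigma_subadditive : sigma_subadditive (@lout R d).
Proof.
move=> A; have [[i ioo]|] := pselect (exists i, lout (A i) = +oo%E).
  rewrite (eseries_pinfty _ _ ioo) ?leey// => k _.
  by rewrite -ltNye (lt_le_trans _ (lout_ge0 _)).
rewrite -forallNE => Aoo.
have fA i : lout (A i) \is a fin_num.
  by rewrite ge0_fin_numE ?lout_ge0// ltey; apply/eqP/Aoo.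
suff add2e (e : {posnum R}) :
    (lout (\bigcup_n A n) <= \sum_(i <oo) lout (A i) + e%:num%:E)%E.
  by apply/lee_addgt0Pr => _/posnumP[].
rewrite (le_trans _ (epsilon_trick _ _ _))//; last by move=> k; exact: lout_ge0.
pose P k (ab : (nat -> V) * (nat -> V)) := A k `<=` \bigcup_j box (ab.1 j) (ab.2 j) /\
  (\sum_(0 <= j <oo) ((vol (ab.1 j) (ab.2 j))%:E)
    <= lout (A k) + (e%:num / (2 ^ k.+1)%:R)%:E)%E.
have [G PG] : {G : nat -> (nat -> V) * (nat -> V) & forall k, P k (G k)}.
  apply: choice => k.
  have e0 : 0 < e%:num / (2 ^ k.+1)%:R :> R by [].
  by have [a [b ab]] := lout_adherent e0 (fA k); exists (a, b).
pose F (ij : nat * nat) := (vol ((G ij.1).1 ij.2) ((G ij.1).2 ij.2))%:E.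
have F0 x : (0 <= F x)%E by rewrite lee_fin vol_ge0.
apply: (@le_trans _ _ (\esum_(i in setT) F i)%E).
  apply: ereal_inf_lbound => /=.
  have /card_esym/ppcard_eqP[f] := card_nat2.
  exists (fun i => (G (f i).1).1 (f i).2), (fun i => (G (f i).1).2 (f i).2).
  split.
    apply: (@subset_trans _  (\bigcup_n \bigcup_k box ((G n).1 k) ((G n).2 k))).
      by move=> t [i _] /(PG i).1 [j _ ?]; exists i => //; exists j.
    move=> t [i _ [j _ Bijt]]; exists (f^-1%FUN (i, j)) => //=.
    by rewrite invK ?inE.
  rewrite [RHS](_ : _ = (\sum_(0 <= i <oo) F (f i))%E)//.
  rewrite nneseries_esumT//.
  by rewrite -(esum_image setT f F) ?image_eq.
rewrite (_ : esum _ _ = (\sum_(i <oo) \sum_(j <oo ) F (i, j))%E); last first.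
  rewrite nneseries_esumT; last by move=> i; exact: nneseries_ge0.
  under [in RHS]eq_esum do rewrite nneseries_esumT//.
  rewrite esum_esum//; congr esum.
  by apply/seteqP; split => -[i j].
apply: lee_lim.
- by apply: is_cvg_nneseries => k *; exact: nneseries_ge0.
- by apply: is_cvg_nneseries => k *; apply: adde_ge0 => //; exact: lout_ge0.
- by near=> k; apply: lee_sum => i _; exact: (PG i).2.
Unshelve. all: by end_near. Qed.

HB.instance Definition _ := isOuterMeasure.Build R V (@lout R d) lout0
  lout_ge0 le_lout lout_sigma_subadditive.

End outer_measure.

Definition upd (R : realType) (d : nat) (x : 'rV[R]_d) (i : 'I_d) (v : R) : 'rV[R]_d :=
  \row_j if j == i then v else x 0 j.

Lemma updE (R : realType) (d : nat) (x : 'rV[R]_d) (i : 'I_d) (v : R) j :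
  upd x i v 0 j = if j == i then v else x 0 j.
Proof. by rewrite mxE. Qed.

(** Half-open, so that cutting at a coordinate hyperplane gives a disjoint union of two boxes of the
    same kind. *)
Definition hbox (R : realType) (d : nat) (a b : 'rV[R]_d) : set 'rV[R]_d :=
  [set x | forall i, a 0 i < x 0 i <= b 0 i].

Section measurable_sets.
Variables (R : realType) (n : nat).
Local Notation d := n.+1.
Local Notation V := 'rV[R]_d.

(** The truncation at 0 in [vol] makes this hold for every [c]: if the hyperplane misses the box,
    one of the two parts has crossed or equal endpoints and counts 0. *)
Lemma vol_split (a b : V) (i : 'I_d) (c : R) :
  vol a b = vol a (upd b i (Num.min (b 0 i) c)) + vol (upd a i (Num.max (a 0 i) c)) b.
Proof.
rewrite /vol [LHS](bigD1 i)//= [X in _ = X + _](bigD1 i)//= [X in _ = _ + X](bigD1 i)//= !updE eqxx.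
rewrite [X in _ = _ * X + _](eq_bigr (fun j => Num.max (b 0 j - a 0 j) 0)); last first.
  by move=> j ji; rewrite !updE (negbTE ji).
rewrite [X in _ = _ + _ * X](eq_bigr (fun j => Num.max (b 0 j - a 0 j) 0)); last first.
  by move=> j ji; rewrite !updE (negbTE ji).
rewrite -mulrDl; congr (_ * _).
by rewrite /Num.max /Num.min; do ! case: ifPn; lra.
Qed.

(** The hyperplane cuts every cover of a test set into covers of its two parts, and by [vol_split]
    the total volume is unchanged. *)
Lemma lmeas_le_coord (i : 'I_d) (c : R) : lmeas [set x : V | x 0 i <= c].
Proof.
apply: (le_caratheodory_measurable (mu := @lout R d)) => X.
apply: le_ereal_inf_tmp => _ [a [b [Xab ->]]].
pose b' k : V := upd (b k) i (Num.min (b k 0 i) c).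
pose a' k : V := upd (a k) i (Num.max (a k 0 i) c).
rewrite (_ : (\sum_(0 <= k <oo) _)%E = ((\sum_(0 <= k <oo) (vol (a k) (b' k))%:E) +
  (\sum_(0 <= k <oo) (vol (a' k) (b k))%:E))%E); last first.
  rewrite -nneseriesD; last 2 first.
  - by move=> k _ _; rewrite lee_fin vol_ge0.
  - by move=> k _ _; rewrite lee_fin vol_ge0.
  by apply: eq_eseriesr => k _; rewrite -EFinD -vol_split.
apply: leeD; apply: ereal_inf_lbound.
- exists a, b'; split => // x [/Xab[k _ xk] xc]; exists k => // j.
  rewrite updE; case: eqP => [->|_]; last exact: xk.
  by have /andP[-> /=] := xk i; rewrite le_min xc andbT.
- exists a', b; split => // x [/Xab[k _ xk] /negP xc]; exists k => // j.
  rewrite updE; case: eqP => [->|_]; last exact: xk.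
  by have /andP[h -> /=] := xk i; rewrite andbT ge_max h ltW// ltNge.
Qed.

Local Notation U := (caratheodory_type (@lout R d)).

Lemma lmeasE (A : set V) : lmeas A = measurable (A : set U).
Proof. by []. Qed.

Lemma lmeasC (A : set V) : lmeas A -> lmeas (~` A).
Proof. exact: (@measurableC _ U). Qed.

Lemma lmeasI (A B : set V) : lmeas A -> lmeas B -> lmeas (A `&` B).
Proof. exact: (@measurableI _ U). Qed.

Lemma lmeas_gt_coord (i : 'I_d) (c : R) : lmeas [set x : V | c < x 0 i].
Proof.
rewrite (_ : mkset _ = ~` [set x : V | x 0 i <= c]); first exact/lmeasC/lmeas_le_coord.
by apply/seteqP; split => x /=; [move=> h; apply/negP|move/negP]; rewrite -ltNge.
Qed.

Lemma lmeas_lt_coord (i : 'I_d) (c : R) : lmeas [set x : V | x 0 i < c].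
Proof.
rewrite (_ : mkset _ = \bigcup_k [set x : V | x 0 i <= c - k.+1%:R^-1]).
  apply: (@bigcupT_measurable _ U) => k; exact: lmeas_le_coord.
apply/seteqP; split => x /=.
  move=> xc; have /ltr_add_invr[k] : x 0 i < c by [].
  by move=> h; exists k => //=; rewrite lerBrDr ltW.
by move=> [k _ /=] /le_lt_trans; apply; rewrite gtrBl.
Qed.

Lemma lmeas_ge_coord (i : 'I_d) (c : R) : lmeas [set x : V | c <= x 0 i].
Proof.
rewrite (_ : mkset _ = ~` [set x : V | x 0 i < c]); first exact/lmeasC/lmeas_lt_coord.
by apply/seteqP; split => x /=; rewrite leNgt => /negP.
Qed.

Lemma lmeas_forall (P : 'I_d -> set V) : (forall i, lmeas (P i)) ->
  lmeas [set x | forall i, P i x].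
Proof.
move=> mP; rewrite (_ : mkset _ = \bigcap_i P i); last first.
  by apply/seteqP; split => x /= h i //; exact: h.
apply: (@fin_bigcap_measurable _ U); first exact: finite_finset.
by move=> i _; exact: mP.
Qed.

Lemma lmeas_box (a b : V) : lmeas (box a b).
Proof.
apply: lmeas_forall => i.
rewrite (_ : (fun _ => _) = [set x : V | a 0 i <= x 0 i] `&` [set x : V | x 0 i <= b 0 i]).
  by apply: lmeasI; [exact: lmeas_ge_coord|exact: lmeas_le_coord].
by apply/seteqP; split => x /= /andP.
Qed.

Lemma lmeas_hbox (a b : V) : lmeas (hbox a b).
Proof.
apply: lmeas_forall => i.
rewrite (_ : (fun _ => _) = [set x : V | a 0 i < x 0 i] `&` [set x : V | x 0 i <= b 0 i]).
  by apply: lmeasI; [exact: lmeas_gt_coord|exact: lmeas_le_coord].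
by apply/seteqP; split => x /= /andP.
Qed.

Lemma hbox_sub_box (a b : V) : hbox a b `<=` box a b.
Proof. by move=> x abx i; have /andP[/ltW -> ->] := abx i. Qed.

(* A cover of the box, integrated over one coordinate after the other. *)
Lemma cover_vol (a b : V) (A B : nat -> V) : (forall i, a 0 i <= b 0 i) ->
  hbox a b `<=` \bigcup_k box (A k) (B k) ->
  ((vol a b)%:E <= \sum_(0 <= k <oo) (vol (A k) (B k))%:E)%E.
Proof.
move=> ab cov.
pose I k j : set R := `[A k 0 j, B k 0 j]%classic.
(* The first [m] factors are side lengths, the others indicators. For [m] = 0 the sum over [k]
   counts the boxes that contain [x], for [m] = d it is the total volume; each induction step
   integrates one indicator over its coordinate. *)
pose w (m : nat) k (x : V) (j : 'I_d) : R :=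
  if (j < m)%N then Num.max (B k 0 j - A k 0 j) 0 else \1_(I k j) (x 0 j).
have w0 m k x j : 0 <= w m k x j.
  by rewrite /w; case: ifP => _; rewrite ?le_max ?lexx ?orbT// indicE; case: (_ \in _).
suff P m : (m <= d)%N -> forall x, hbox a b x ->
    ((\prod_(j < d | (j < m)%N) (b 0 j - a 0 j))%:E <=
     \sum_(0 <= k <oo) (\prod_(j < d) w m k x j)%:E)%E.
  (* For [m] = d the point no longer matters, but one is needed: [b] lies in the half-open box as
     soon as no side is degenerate, and otherwise the volume is 0. *)
  have [/existsP[i /eqP abi]|/existsPn abi] := boolP [exists i, a 0 i == b 0 i].
    rewrite volE// (bigD1 i)//= abi subrr mul0r.
    by apply: nneseries_ge0 => k _ _; rewrite lee_fin vol_ge0.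
  have := P d (leqnn _) b; rewrite volE//.
  under eq_bigl do rewrite ltn_ord.
  move=> /(_ _)/le_trans; apply.
    by move=> i; rewrite lexx andbT lt_neqAle ab abi.
  rewrite le_eqVlt; apply/orP; left; apply/eqP.
  apply: eq_eseriesr => k _; congr EFin.
  by apply: eq_bigr => j _; rewrite /w ltn_ord.
elim: m => [_ x abx|m IH md x abx].
  rewrite big_pred0//.
  have [k _ xk] := cov _ abx.
  rewrite (nneseries_split 0 k.+1); last first.
    by move=> i _; rewrite lee_fin; apply: prodr_ge0.
  apply: le_trans (leeDl _ _); last first.
    by apply: nneseries_ge0 => i _ _; rewrite lee_fin; apply: prodr_ge0.
  rewrite add0n big_nat_recr//= [X in (_ + X%:E)%E](_ : _ = 1).
    by apply: leeDr; apply: sume_ge0 => i _; rewrite lee_fin; apply: prodr_ge0.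
  apply: big1 => j _; rewrite /w/= indicE mem_set//= /I/= in_itv/=.
  exact: xk.
pose i0 : 'I_d := Ordinal md.
have mi0 : (i0 = m :> nat) by [].
pose c := \prod_(j < d | (j < m)%N) (b 0 j - a 0 j).
have c0 : 0 <= c by apply: prodr_ge0 => j _; rewrite subr_ge0.
pose v k := \prod_(j < d | j != i0) w m.+1 k x j.
have v0 k : 0 <= v k by exact: prodr_ge0.
pose D : set R := `]a 0 i0, b 0 i0]%classic.
have mD : measurable D by exact: measurable_itv.
have mI k : measurable (I k i0) by exact: measurable_itv.
pose g k (t : R) : \bar R := ((v k)%:E * (\1_(I k i0) t)%:E)%E.
have g0 k t : (0 <= g k t)%E.
  by rewrite mule_ge0// lee_fin// indicE; case: (_ \in _).
have key t : D t -> (c%:E <= \sum_(0 <= k <oo) g k t)%E.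
  move=> Dt; have /(IH (ltnW md))/le_trans -> // : hbox a b (upd x i0 t).
    move=> j; rewrite updE; case: eqP => [->|_]; last exact: abx.
    by move: Dt; rewrite /D/= in_itv.
  rewrite le_eqVlt; apply/orP; left; apply/eqP.
  apply: eq_eseriesr => k _; rewrite /g -EFinM; congr EFin.
  rewrite (bigD1 i0)//= mulrC /w mi0 ltnn updE eqxx; congr (_ * _).
  apply: eq_bigr => j ji0; rewrite updE (negbTE ji0) /w ltnS (leq_eqVlt j).
  have -> : (j == m :> nat) = false by apply/negbTE.
  by [].
have mi k : measurable_fun D (fun t => (\1_(I k i0) t : R)%:E).
  by apply/measurable_EFinP; exact: measurable_indic.
have mw k : measurable_fun D (g k) by apply: measurable_funeM; exact: mi.
have : (\int[lebesgue_measure]_(t in D) (cst c%:E t) <=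
  \int[lebesgue_measure]_(t in D) (\sum_(0 <= k <oo) g k t))%E.
  apply: ge0_le_integral => //.
  exact: (ge0_emeasurable_sum (P := xpredT) (fun k x _ _ => g0 k x) (fun k _ => mw k)).
rewrite integral_cst// integral_nneseries//.
have leb : lebesgue_measure D = (b 0 i0 - a 0 i0)%:E.
  rewrite /D lebesgue_measure_itv/= lte_fin; case: ltP => // h.
  by rewrite (_ : b 0 i0 = a 0 i0) ?subrr//; apply/eqP; rewrite eq_le h ab.
rewrite [X in (_ * X <= _)%E]leb -EFinM.
have -> : \prod_(j < d | (j < m.+1)%N) (b 0 j - a 0 j) = c * (b 0 i0 - a 0 i0).
  rewrite (bigD1 i0)/= ?mi0// mulrC; congr (_ * _).
  apply: eq_bigl => j; rewrite ltnS ltn_neqAle andbC.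
  by rewrite -(inj_eq val_inj j i0).
move=> /le_trans; apply.
apply: lee_nneseries => k _; first by move=> _; exact: integral_ge0.
rewrite /g.
rewrite ge0_integralZl_EFin//; last first.
  exact: mi.
rewrite [X in (_ * X <= _)%E](integral_indic lebesgue_measure mD (mI k))
    (_ : \prod_(j < d) w m.+1 k x j
  = v k * Num.max (B k 0 i0 - A k 0 i0) 0); last first.
  by rewrite (bigD1 i0)// mulrC /= /w ltnSn.
rewrite EFinM.
apply: lee_wpmul2l; first by rewrite lee_fin.
apply: (@le_trans _ _ ((lebesgue_measure : measure _ R) (I k i0))).
  by apply: le_measure; rewrite ?inE//; [exact: measurableI (mI k) mD|exact: mI].
rewrite /I [X in (X <= _)%E]lebesgue_measure_itv/= lte_fin.
case: ltP => h; rewrite -?EFinB lee_fin le_max ?lexx ?orbT//.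
Qed.

Lemma vol_le_lout (a b : V) : (forall i, a 0 i <= b 0 i) ->
  ((vol a b)%:E <= lout (hbox a b))%E.
Proof.
move=> ab; apply: le_ereal_inf_tmp => _ [A [B [cov ->]]].
exact: cover_vol.
Qed.

Lemma lout_hbox (a b : V) : (forall i, a 0 i <= b 0 i) ->
  lout (hbox a b) = (vol a b)%:E.
Proof.
move=> ab; apply/eqP; rewrite eq_le vol_le_lout// andbT.
by apply: le_trans (lout_le_vol _ _); apply: le_lout; exact: hbox_sub_box.
Qed.

Definition boxc (x : V) (e : R) : set V := box (x - const_mx e) (x + const_mx e).

Lemma boxcP (x : V) (e : R) y : boxc x e y <-> forall i, `|y 0 i - x 0 i| <= e.
Proof.
split => h i; have := h i; first by rewrite !mxE ler_distl.
by rewrite !mxE ler_distl.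
Qed.

Lemma nbhs_boxc (x : V) (A : set V) : nbhs x A ->
  exists2 e, 0 < e & boxc x e `<=` A.
Proof.
move=> /nbhs_ballP[e /= e0 xeA]; exists (e / 2); first by rewrite divr_gt0.
move=> y /boxcP xy; apply: xeA; split => // i j; rewrite ord1 /ball/= distrC.
by apply: le_lt_trans (xy j) _; rewrite ltr_pdivrMr// mulr_natr mulr2n ltrDl.
Qed.

Lemma boxc_nbhs (x : V) (e : R) : 0 < e -> nbhs x (boxc x e).
Proof.
move=> e0; apply/nbhs_ballP; exists e => // y xy; apply/boxcP => i.
by have := xy.2 0 i; rewrite /ball/= distrC => /ltW.
Qed.

Lemma lout_open_gt0 (D : set V) (x : V) : nbhs x D -> (0 < lout D)%E.
Proof.
move=> /nbhs_boxc[e e0 xeD].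
apply: (@lt_le_trans _ _ (lout (hbox (x - const_mx e) (x + const_mx e)))).
  rewrite lout_hbox => [|i]; last by rewrite !mxE; lra.
  rewrite volE => [|i]; last by rewrite !mxE; lra.
  by rewrite lte_fin; apply: prodr_gt0 => i _; rewrite !mxE; lra.
by apply: le_lout; exact: subset_trans (@hbox_sub_box _ _) xeD.
Qed.

Definition ratbox (q : 'rV[rat]_d * 'rV[rat]_d) : set V :=
  box (map_mx ratr q.1) (map_mx ratr q.2).

Lemma nbhs_ratbox (x : V) (A : set V) : nbhs x A ->
  exists q, ratbox q x /\ ratbox q `<=` A.
Proof.
move=> /nbhs_boxc[e e0 xeA].
have /choice[p hp] (i : 'I_d) : exists q : rat, x 0 i - e < ratr q < x 0 i.
  have h : x 0 i - e < x 0 i by lra.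
  by have [q] := rat_in_itvoo h; rewrite in_itv/=; exists q.
have /choice[q hq] (i : 'I_d) : exists q : rat, x 0 i < ratr q < x 0 i + e.
  have h : x 0 i < x 0 i + e by lra.
  by have [q] := rat_in_itvoo h; rewrite in_itv/=; exists q.
exists (\row_i p i, \row_i q i); split.
  by move=> i; rewrite !mxE; have := hp i; have := hq i; lra.
move=> y h; apply: xeA => i; have := h i; rewrite !mxE.
by have := hp i; have := hq i; lra.
Qed.

Lemma lmeas_open (D : set V) : open D -> lmeas D.
Proof.
move=> oD.
pose F q : set V := if `[< ratbox q `<=` D >] then ratbox q else set0.
rewrite (_ : D = \bigcup_q F q).
  apply: (@countable_bigcupT_measurable _ U) => [|q]; first exact: countableP.
  by rewrite /F; case: ifP => _; [exact: lmeas_box|exact: (@measurable0 _ U)].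
apply/seteqP; split => [x Dx|x [q _]]; last first.
  by rewrite /F; case: ifPn => // /asboolP; exact.
have [q [qx qD]] := nbhs_ratbox (open_nbhs_nbhs (conj oD Dx)).
by exists q => //; rewrite /F; case: ifPn => // /asboolP.
Qed.

(** A Lindelöf argument: the rational boxes that meet [E] in a null set are countably many and cover
    [D]. *)
Lemma lout_local (D E : set V) : open D ->
  (forall x, D x -> exists2 A, nbhs x A & lout (A `&` E) = 0%E) ->
  lout (D `&` E) = 0%E.
Proof.
move=> oD loc.
pose F q : set U := if `[< lout (ratbox q `&` E) = 0%E >] then ratbox q `&` E else set0.
apply/eqP; rewrite eq_le lout_ge0 andbT.
pose G k := if (unpickle k : option ('rV[rat]_d * 'rV[rat]_d)) is Some q then F q else set0.
apply: (@le_trans _ _ (lout (\bigcup_k G k))).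
  apply: le_lout => x [Dx Ex].
  have [A nA A0] := loc _ Dx; have [q [qx qA]] := nbhs_ratbox nA.
  exists (pickle q) => //; rewrite /G pickleK /F; case: ifPn => // /asboolP[].
  apply/eqP; rewrite eq_le lout_ge0 andbT -A0; apply: le_lout.
  by apply: setSI.
apply: le_trans (lout_sigma_subadditive _) _.
rewrite eseries0// => k _ _; rewrite /G; case: unpickle => [q|]; last exact: lout0.
by rewrite /F; case: ifPn => [/asboolP//|_]; exact: lout0.
Qed.

Lemma ae_dense (D : set V) (P : V -> Prop) (x : V) : open D -> ae_on D P -> D x ->
  forall A, nbhs x A -> exists y, [/\ A y, D y & P y].
Proof.
move=> oD aeP Dx A nA; apply: contrapT => nex.
have : (0 < lout (A `&` D))%E.
  by apply: (lout_open_gt0 (x := x)); apply: filterI => //; exact: open_nbhs_nbhs.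
rewrite ltNge => /negP; apply; rewrite -aeP; apply: le_lout => y [Ay Dy].
by split => // Py; apply: nex; exists y.
Qed.

End measurable_sets.

(** * The Lebesgue integral *)

(** A second name for [lout], on its Carathéodory sigma-algebra: it carries the measure structure,
    while [lout] keeps that of an outer measure. *)
Definition lebd (R : realType) (n : nat) :
  set (caratheodory_type (@lout R n.+1)) -> \bar R := @lout R n.+1.

HB.instance Definition _ (R : realType) (n : nat) :=
  isMeasure.Build _ _ _ (@lebd R n) (@caratheodory_measure0 _ _ (@lout R n.+1))
    (@caratheodory_measure_ge0 _ _ (@lout R n.+1))
    (@caratheodory_measure_sigma_additive _ _ (@lout R n.+1)).

Section lebesgue_integral.
Variables (R : realType) (n : nat).
Local Notation d := n.+1.
Local Notation V := 'rV[R]_d.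
Local Notation U := (caratheodory_type (@lout R d)).
Local Notation mu := (@lebd R n).

(** Tonelli's theorem in [layer_cake] rests on this. *)
Lemma lebd_sigma_finite : sigma_finite [set: U] mu.
Proof.
exists (fun k => box (const_mx (- k%:R)) (const_mx k%:R)).
  apply/seteqP; split => // x _.
  pose M := \sum_(i < d) `|(x : V) 0 i|.
  have [k Mk] : exists k : nat, M <= k%:R.
    exists (Num.truncn M).+1; apply: ltW; apply: truncnS_gt.
  exists k => // i; rewrite !mxE -ler_norml; apply: le_trans Mk.
  by rewrite /M (bigD1 i)//= lerDl sumr_ge0.
move=> k; split; first exact: lmeas_box.
by apply: le_lt_trans (lout_le_vol _ _) _; rewrite ltry.
Qed.

HB.instance Definition _ := @Measure_isSigmaFinite.Build _ U R mu lebd_sigma_finite.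

Lemma lmeasfunP (D : set V) (u : V -> R) : lmeas D ->
  lmeasfun D u <-> measurable_fun (D : set U) (u : U -> R).
Proof.
move=> mD; split=> [mu_ | mu_ t].
  apply: (measurability _ (RGenOInfty.measurableE R)).
  move=> _ [_ [t ->] <-].
  have := mu_ t; congr lmeas; apply/seteqP.
  by split=> x /= [Dx]; rewrite in_itv/= andbT.
have := mu_ mD _ (@measurable_itv R `]t, +oo[).
congr lmeas; apply/seteqP.
by split=> x /= [Dx]; rewrite in_itv/= andbT.
Qed.

(* Tonelli on the region {(x, t) | 0 <= t < u x}. *)
Lemma layer_cake (D : set V) (u : V -> R) : lmeas D ->
  (forall x, D x -> 0 <= u x) -> measurable_fun (D : set U) (u : U -> R) ->
  lint_nn D u = (\int[mu]_(x in (D : set U)) (u x)%:E)%E.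
Proof.
move=> mD u0 mu_.
pose v : U -> R := u \_ D.
have vE x : v x = if x \in D then u x else 0 by rewrite /v patchE.
have v0 x : 0 <= v x by rewrite vE; case: ifPn => // /set_mem; exact: u0.
have mv : measurable_fun setT v.
  have [H _] := measurable_restrictT (u : U -> R) (mD : measurable (D : set U)).
  exact: H.
pose F (z : U * measurableTypeR R) : \bar R :=
  (\1_[set z : U * measurableTypeR R | 0 <= (z.2 : R) /\ (z.2 : R) < v z.1] z)%:E.
have F0 z : (0 <= F z)%E by rewrite lee_fin indicE; case: (_ \in _).
have mF : measurable_fun setT F.
  apply/measurable_EFinP; apply: measurable_indic.
  pose f1 (z : U * measurableTypeR R) := (0 <= (z.2 : R))%R.
  pose f2 (z : U * measurableTypeR R) := ((z.2 : R) < v z.1)%R.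
  rewrite [X in measurable X](_ : _ = f1 @^-1` [set true] `&` f2 @^-1` [set true]); last first.
    by apply/seteqP; split => z /= [].
  apply: measurableI.
  - have : measurable_fun setT f1 by exact: measurable_fun_ler.
    by move=> /(_ measurableT [set true]); rewrite setTI; exact.
  - have : measurable_fun setT f2.
      apply: measurable_fun_ltr; first exact: measurable_snd.
      exact: measurableT_comp mv measurable_fst.
    by move=> /(_ measurableT [set true]); rewrite setTI; exact.
have := @fubini_tonelli _ _ U (measurableTypeR R) R mu lebesgue_measure F mF F0.
have -> : (\int[mu]_x \int[lebesgue_measure]_y F (x, y) =
           \int[mu]_(x in (D : set U)) (u x)%:E)%E.
  rewrite [RHS]integral_mkcond; apply: eq_integral => x _.
  transitivity (v x)%:E; last by rewrite vE patchE; case: ifP.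
  transitivity (\int[lebesgue_measure]_y (\1_(`[0, v x[%classic : set (measurableTypeR R)) y)%:E)%E.
    apply: eq_integral => y _; rewrite /F !indicE; congr (_%:R)%:E; congr nat_of_bool.
    by apply/idP/idP; rewrite !inE/= in_itv/= => /andP.
  rewrite [LHS](integral_indic lebesgue_measure measurableT (measurable_itv `[0, v x[)).
  rewrite setIT [LHS]lebesgue_measure_itv/= lte_fin oppr0 adde0; case: ltP => // h.
  by congr EFin; apply/eqP; rewrite eq_le h v0.
move=> ->; rewrite /lint_nn [LHS]integral_mkcond; apply: eq_integral => t _.
rewrite patchE; case: ifPn => [|tn].
  rewrite inE/= in_itv/= andbT => t0.
  rewrite (_ : (fun x => F (x, t)) = (fun x => (\1_[set x : U | D x /\ t < u x] x)%:E)); last first.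
    apply/funext => x; rewrite /F !indicE; congr (_%:R)%:E; congr nat_of_bool.
    apply/idP/idP; rewrite !inE/= vE.
      by move=> [_]; case: ifPn => [/set_mem//|_]; rewrite ltNge t0.
    by move=> [Dx tu]; rewrite mem_set.
  rewrite integral_indic ?setIT//.
  by have /lmeasfunP := mu_; apply.
apply/esym; apply: integral0_eq => x _; rewrite /F indicE.
rewrite memNset//= => -[t0]; move: tn; rewrite notin_setE/= in_itv/= andbT.
by move/negP; rewrite t0.
Qed.

Lemma lintE (D : set V) (f : V -> R) : lmeas D ->
  mu.-integrable (D : set U) (fun x => (f x)%:E) ->
  lint D f = Rintegral mu (D : set U) (f : U -> R).
Proof.
move=> mD intf; have mf : measurable_fun (D : set U) (f : U -> R).
  by apply/measurable_EFinP; exact: measurable_int intf.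
rewrite /Rintegral integralE fineB; last 2 first.
- exact: integrable_pos_fin_num.
- exact: integrable_neg_fin_num.
have m1 : measurable_fun (D : set U) (fun x : U => Num.max (f x) 0).
  by apply: measurable_maxr => //; exact: measurable_cst.
have m2 : measurable_fun (D : set U) (fun x : U => Num.max (- f x) 0).
  apply: measurable_maxr; last exact: measurable_cst.
  exact: (measurableT_comp (@oppr_measurable R setT) mf).
have p1 x : D x -> 0 <= Num.max (f x) 0 by rewrite le_max lexx orbT.
have p2 x : D x -> 0 <= Num.max (- f x) 0 by rewrite le_max lexx orbT.
rewrite /lint (layer_cake mD p1 m1) (layer_cake mD p2 m2).
congr (fine _ - fine _); apply: eq_integral => x _.
- by rewrite funeposE EFin_max.
- by rewrite funenegE EFin_max EFinN.
Qed.

(** On a set of finite measure |u| <= 1 + |u|^p is integrable, as p >= 1. *)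
Lemma Lp_integrable (p : R) (D K : set V) (u : V -> R) : 1 <= p ->
  lmeas D -> Lp p D u -> lmeas K -> K `<=` D -> (lout K < +oo)%E ->
  mu.-integrable (K : set U) (fun x => (u x)%:E).
Proof.
move=> p1 mD [/(lmeasfunP _ mD) mu_ fin] mK KD Kfin.
have mpow : measurable_fun (D : set U) (fun x => powR `|u x| p).
  apply: (measurableT_comp (measurable_powR p)).
  exact: (measurableT_comp (@normr_measurable R setT)).
have muK : measurable_fun (K : set U) (u : U -> R) by apply: measurable_funS mu_.
have mpowK : measurable_fun (K : set U) (fun x => powR `|u x| p).
  by apply: measurable_funS mpow.
apply/integrableP; split; first exact/measurable_EFinP.
apply: (@le_lt_trans _ _ (\int[mu]_(x in (K : set U)) (1 + (powR `|u x| p)%:E))%E).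
  apply: ge0_le_integral.
  - exact: mK.
  - by move=> x _; exact: abse_ge0.
  - apply/measurable_EFinP; exact: (measurableT_comp (@normr_measurable R setT) muK).
  - by apply: emeasurable_funD; [exact: measurable_cst|exact/measurable_EFinP].
  - move=> x _; rewrite -EFinD lee_fin.
    have [u1|u1] := leP `|u x| 1; first by apply: le_trans u1 _; rewrite lerDl powR_ge0.
    rewrite -{1}(@powRr1 _ `|u x|)// ler_wpDl//.
    by apply: ler_powR => //; exact: ltW.
rewrite ge0_integralD; last 5 first.
- exact: mK.
- by move=> x _; rewrite lee_fin ler01.
- exact: measurable_cst.
- by move=> x _; rewrite lee_fin powR_ge0.
- exact/measurable_EFinP.
apply: lte_add_pinfty.
  by rewrite (integral_cst _ (mK : measurable (K : set U))) mul1e.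
apply: le_lt_trans fin; rewrite (layer_cake mD _ mpow); last by move=> x _; exact: powR_ge0.
apply: ge0_subset_integral.
- exact: mK.
- exact: mD.
- exact/measurable_EFinP.
- by move=> x _; rewrite lee_fin powR_ge0.
- exact: KD.
Qed.

End lebesgue_integral.

(** * Smooth functions *)

Section is_derive_facts.
Variables (R : realType) (V : normedModType R).
Implicit Types (f : V -> R) (x v : V).

Lemma is_derive_cvg f x v (L : R) :
  h^-1 * (f (h *: v + x) - f x) @[h --> 0^'] --> L -> is_derive x v f L.
Proof. by move=> H; apply: DeriveDef; [exact: cvgP H|exact: cvg_lim H]. Qed.

Lemma cvg_is_derive f x v (L : R) : is_derive x v f L ->
  h^-1 * (f (h *: v + x) - f x) @[h --> 0^'] --> L.
Proof. by case=> [df <-]; exact: df. Qed.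

End is_derive_facts.
Arguments cvg_is_derive {R V f x v L} _.

Section is_derive_facts.
Variables (R : realType) (V : normedModType R).
Implicit Types (f g : V -> R) (x v : V).

Lemma cvg_line x v : h *: v + x @[h --> (0:R)^'] --> x.
Proof.
have H : h *: v + x @[h --> (0:R)] --> x.
  rewrite -[X in _ --> X]add0r -(scale0r v).
  by apply: cvgD; [apply: cvgZr_tmp; exact: cvg_id|exact: cvg_cst].
by apply: cvg_trans H; apply: cvg_app; exact: cvg_within.
Qed.

Arguments cvg_line x v : clear implicits.

Lemma near_eq_continuous f g x : (\near x, f x = g x) ->
  {for x, continuous f} -> {for x, continuous g}.
Proof.
move=> fg fc; have H : f @ x --> g x by rewrite -(nbhs_singleton fg).
by apply: cvg_trans H; exact: near_eq_cvg.
Qed.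

Lemma continuous_near_neq0 f x : {for x, continuous f} -> f x != 0 ->
  \forall y \near x, f y != 0.
Proof. by move=> fc fx0; have H : f @ x --> f x := fc; exact: (cvgr_neq0 _ H fx0). Qed.

Lemma is_derive_line f x v (L : R) :
  is_derive (0 : R) 1 (fun h : R => f (h *: v + x)) L -> is_derive x v f L.
Proof.
move=> /cvg_is_derive H; apply: is_derive_cvg.
apply: cvg_trans H; apply: near_eq_cvg; near=> h.
by rewrite scale0r add0r addr0 /GRing.scale/= mulr1.
Unshelve. all: by end_near. Qed.

Lemma line_is_derive f x v (t L : R) :
  is_derive (t *: v + x) v f L -> is_derive t 1 (fun h : R => f (h *: v + x)) L.
Proof.
move=> /cvg_is_derive H; apply: is_derive_cvg.
apply: cvg_trans H; apply: near_eq_cvg; near=> h.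
by rewrite [h%:A](_ : _ = h) ?scalerDl ?addrA//; exact: mulr1.
Unshelve. all: by end_near. Qed.

(* x^k - y^k = (x - y) (x^(k-1) + ... + y^(k-1)) turns difference quotients of
   [f ^+ k] into difference quotients of [f]. *)
Lemma is_derive_root f x v k (L : R) : (0 < k)%N -> {for x, continuous f} ->
  f x != 0 -> is_derive x v (fun y => f y ^+ k) L ->
  is_derive x v f (L * (k%:R * f x ^+ k.-1)^-1).
Proof.
move=> k0 fc fx0 /cvg_is_derive H; apply: is_derive_cvg.
have fl : f (h *: v + x) @[h --> (0:R)^'] --> f x.
  exact: (cvg_comp _ _ (@cvg_line x v) fc).
pose q h := \sum_(i < k) f (h *: v + x) ^+ (k.-1 - i) * f x ^+ i.
have cX (F : R -> R) (l : R) m : F h @[h --> 0^'] --> l -> F h ^+ m @[h --> 0^'] --> l ^+ m.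
  move=> Fl; elim: m => [|m IH]; first by rewrite expr0; exact: cvg_cst.
  by rewrite exprS; under eq_fun do rewrite exprS; exact: cvgM.
have qc : q h @[h --> (0:R)^'] --> k%:R * f x ^+ k.-1.
  rewrite (_ : k%:R * _ = \sum_(i < k) f x ^+ (k.-1 - i) * f x ^+ i); last first.
    rewrite (eq_bigr (fun=> f x ^+ k.-1)) ?sumr_const ?card_ord ?mulr_natl// => i _.
    by rewrite -exprD subnK// -ltnS prednK.
  have cS m : \sum_(i < m) f (h *: v + x) ^+ (k.-1 - i) * f x ^+ i @[h --> (0:R)^']
      --> \sum_(i < m) f x ^+ (k.-1 - i) * f x ^+ i.
    elim: m => [|m IH]; first by rewrite big_ord0; under eq_fun do rewrite big_ord0; exact: cvg_cst.
    rewrite big_ord_recr/=; under eq_fun do rewrite big_ord_recr/=.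
    by apply: cvgD => //; apply: cvgM; [exact: cX|exact: cvg_cst].
  exact: cS.
have q0 : k%:R * f x ^+ k.-1 != 0 by rewrite mulf_neq0 ?expf_neq0// pnatr_eq0 -lt0n.
apply: cvg_trans (cvgM H (cvgV q0 qc)); apply: near_eq_cvg.
have : \forall h \near (0:R)^', q h != 0.
  exact: (cvgr_neq0 _ qc q0).
apply: filterS => h qh0 /=.
by rewrite subrXX -/(q h) -!mulrA mulfV ?mulr1.
Qed.

End is_derive_facts.

Section smooth_class.
Variables (R : realType) (d : nat).
Local Notation V := 'rV[R]_d.
Implicit Types (D : set V) (f g : V -> R).

(** The class C^m, by recursion on the order so that closure properties follow by induction. The
    recursion differentiates [g] itself first, whereas [ipartial] puts the head of the sequence
    outermost; hence the [rcons] in [smooth_onP]. *)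
Fixpoint Cn m D g : Prop :=
  (forall x, D x -> {for x, continuous g}) /\
  (if m is m'.+1 then
     forall i, (forall x, D x -> derivable g x (evec R i)) /\ Cn m' D (partial i g)
   else True).

Lemma Cn_cont m D g : Cn m D g -> forall x, D x -> {for x, continuous g}.
Proof. by case: m => [|m] []. Qed.

Arguments Cn_cont {m D g} _ x _.

Lemma CnW m D g : Cn m.+1 D g -> Cn m D g.
Proof.
elim: m g => [|m IH] g; first by case=> gc _; split.
case=> gc h; split => // i; have [hd hC] := h i; split => //; exact: IH.
Qed.

Lemma smooth_onP D g : smooth_on D g <-> forall m, Cn m D g.
Proof.
split=> [gs m|gC s x Dx].
  elim: m g gs => [|m IH] g gs; first by split=> // x Dx; exact: (gs [::] x Dx).2.
  split=> [x Dx|i]; first exact: (gs [::] x Dx).2.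
  split=> [x Dx|]; first exact: (gs [::] x Dx).1.
  by apply: IH => s x Dx; have := gs (rcons s i) x Dx; rewrite /ipartial foldr_rcons.
have gsC : forall m, Cn m D (ipartial s g).
  by elim: s => [//|i s IH] m; have [_ /(_ i)[]] := IH m.+1.
split=> [i|]; last exact: Cn_cont (gsC 0%N) x Dx.
by have [_ /(_ i)[h _]] := gsC 1%N; exact: h.
Qed.

Lemma smooth_on_local D g :
  (forall x, D x -> exists2 A, A x & smooth_on A g) -> smooth_on D g.
Proof. by move=> H s x /H[A Ax gA]; exact: gA. Qed.

Section open_domain.
Variable D : set V.
Hypothesis oD : open D.

Lemma open_near x f g : D x -> (forall y, D y -> f y = g y) -> \near x, f x = g x.
Proof.
move=> Dx fg; have : \forall y \near x, D y by exact: open_nbhs_nbhs.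
by apply: filterS => y; exact: fg.
Qed.

Lemma Cn_eq m f g : (forall x, D x -> f x = g x) -> Cn m D f -> Cn m D g.
Proof.
elim: m f g => [|m IH] f g fg.
  case=> fc _; split=> // x Dx.
  by apply: near_eq_continuous (fc x Dx); exact: open_near.
case=> fc h; split.
  by move=> x Dx; apply: near_eq_continuous (fc x Dx); exact: open_near.
move=> i; have [hd hC] := h i; split.
  by move=> x Dx; apply: near_eq_derivable (hd x Dx); exact: open_near.
apply: IH hC => x Dx; apply: near_eq_derive.
exact: open_near.
Qed.

Lemma Cn_succ m g (h : 'I_d -> V -> R) :
  (forall x, D x -> {for x, continuous g}) ->
  (forall i x, D x -> is_derive x (evec R i) g (h i x)) ->
  (forall i, Cn m D (h i)) -> Cn m.+1 D g.
Proof.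
move=> gc gh hC; split => // i; split.
  by move=> x Dx; have [] := gh i x Dx.
by apply: (@Cn_eq m (h i)) => // x Dx; have [_ <-] := gh i x Dx.
Qed.

Lemma Cn_is_derive m g i x : Cn m.+1 D g -> D x -> is_derive x (evec R i) g (partial i g x).
Proof. by case=> _ /(_ i)[h _] Dx; apply: DeriveDef => //; exact: h. Qed.

Lemma Cn_partial m g i : Cn m.+1 D g -> Cn m D (partial i g).
Proof. by case=> _ /(_ i)[]. Qed.

Lemma Cn_cst m (c : R) : Cn m D (fun=> c).
Proof.
elim: m c => [|m IH] c; first by split=> // x Dx; exact: cst_continuous.
split=> [x Dx|i]; first exact: cst_continuous.
split=> [x Dx|]; first exact: derivable_cst.
by apply: (@Cn_eq m (fun=> 0)) => // x _; rewrite /partial derive_cst.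
Qed.

Lemma Cn_add m f g : Cn m D f -> Cn m D g -> Cn m D (fun x => f x + g x).
Proof.
elim: m f g => [|m IH] f g fC gC.
  by split=> // x Dx; exact: (cvgD (Cn_cont fC x Dx) (Cn_cont gC x Dx)).
apply: (@Cn_succ _ _ (fun i x => partial i f x + partial i g x)) => [x Dx|i x Dx|i].
- by exact: (cvgD (Cn_cont fC x Dx) (Cn_cont gC x Dx)).
- exact: (is_deriveD (Cn_is_derive i fC Dx) (Cn_is_derive i gC Dx)).
- by apply: IH; exact: Cn_partial.
Qed.

Lemma Cn_mul m f g : Cn m D f -> Cn m D g -> Cn m D (fun x => f x * g x).
Proof.
elim: m f g => [|m IH] f g fC gC.
  by split=> // x Dx; exact: (cvgM (Cn_cont fC x Dx) (Cn_cont gC x Dx)).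
apply: (@Cn_succ _ _ (fun i x => f x * partial i g x + g x * partial i f x)) => [x Dx|i x Dx|i].
- by exact: (cvgM (Cn_cont fC x Dx) (Cn_cont gC x Dx)).
- exact: (is_deriveM (Cn_is_derive i fC Dx) (Cn_is_derive i gC Dx)).
- by apply: Cn_add; apply: IH; solve [exact: CnW|exact: Cn_partial].
Qed.

Lemma Cn_sum m (I : Type) (r : seq I) (P : pred I) (F : I -> V -> R) :
  (forall i, P i -> Cn m D (F i)) -> Cn m D (fun x => \sum_(i <- r | P i) F i x).
Proof.
move=> FC; elim: r => [|i r IH].
  by apply: (@Cn_eq m (fun=> 0)) => [x _|]; [rewrite big_nil|exact: Cn_cst].
have [Pi|Pi] := boolP (P i).
  apply: (@Cn_eq m (fun x => F i x + \sum_(i <- r | P i) F i x)) => [x _|].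
    by rewrite big_cons Pi.
  by apply: Cn_add => //; exact: FC.
by apply: Cn_eq IH => x _; rewrite big_cons (negbTE Pi).
Qed.

Lemma Cn_prod m (I : Type) (r : seq I) (P : pred I) (F : I -> V -> R) :
  (forall i, P i -> Cn m D (F i)) -> Cn m D (fun x => \prod_(i <- r | P i) F i x).
Proof.
move=> FC; elim: r => [|i r IH].
  by apply: (@Cn_eq m (fun=> 1)) => [x _|]; [rewrite big_nil|exact: Cn_cst].
have [Pi|Pi] := boolP (P i).
  apply: (@Cn_eq m (fun x => F i x * \prod_(i <- r | P i) F i x)) => [x _|].
    by rewrite big_cons Pi.
  by apply: Cn_mul => //; exact: FC.
by apply: Cn_eq IH => x _; rewrite big_cons (negbTE Pi).
Qed.

Lemma Cn_inv m f : (forall x, D x -> f x != 0) -> Cn m D f -> Cn m D (fun x => (f x)^-1).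
Proof.
move=> f0; elim: m => [|m IH] fC.
  by split=> // x Dx; exact: (cvgV (f0 x Dx) (Cn_cont fC x Dx)).
apply: (@Cn_succ _ _ (fun i x => -1 * ((f x)^-1 * (f x)^-1 * partial i f x))) => [x Dx|i x Dx|i].
- by exact: (cvgV (f0 x Dx) (Cn_cont fC x Dx)).
- have [df dE] := Cn_is_derive i fC Dx.
  apply: DeriveDef; first by apply: derivableV => //; exact: f0.
  rewrite deriveV ?f0// dE /GRing.scale/= expr2 invfM; ring.
- apply: Cn_mul; first exact: Cn_cst.
  apply: Cn_mul; last exact: Cn_partial.
  by apply: Cn_mul; apply: IH; exact: CnW.
Qed.

(** The derivative of f is that of f^k divided by k f^(k-1), which involves f but no derivative of
    f. Each step therefore gains one order, starting from mere continuity. *)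
Lemma Cn_root k m f : (0 < k)%N -> (forall x, D x -> {for x, continuous f}) ->
  (forall x, D x -> f x != 0) -> Cn m D (fun x => f x ^+ k) -> Cn m D f.
Proof.
move=> k0 fc f0; elim: m => [|m IH] fC; first by split.
have kf0 x : D x -> k%:R * f x ^+ k.-1 != 0.
  by move=> Dx; rewrite mulf_neq0 ?expf_neq0// ?f0// pnatr_eq0 -lt0n.
have IHf := IH (CnW fC).
apply: (@Cn_succ _ _ (fun i x => partial i (fun x => f x ^+ k) x *
    (k%:R * f x ^+ k.-1)^-1)) => // [i x Dx|i].
  apply: is_derive_root => //; [exact: fc|exact: f0|exact: Cn_is_derive fC Dx].
apply: Cn_mul; first exact: Cn_partial fC.
apply: Cn_inv => //; apply: Cn_mul; first exact: Cn_cst.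
apply: (@Cn_eq m (fun x => \prod_(i < k.-1) f x)) => [x _|].
  by rewrite prodr_const card_ord.
by apply: Cn_prod => j _; exact: IHf.
Qed.

End open_domain.

End smooth_class.

(** * Smooth bump functions *)

Section tbump.
Variable R : realType.

(** The functions t^-m e^(-1/t), extended by 0. The factor t^-m makes the family stable under
    differentiation up to linear combinations, so smoothness of all members follows by one
    induction. *)
Definition ebump m (t : R) : R := if 0 < t then t^-1 ^+ m * expR (- t^-1) else 0.

Lemma ebump_ge0 m t : 0 <= ebump m t.
Proof.
by rewrite /ebump; case: ifP => // t0; rewrite mulr_ge0 ?exprn_ge0 ?invr_ge0 ?ltW// expR_gt0.
Qed.

Lemma ebump0_le1 t : ebump 0 t <= 1.
Proof.
rewrite /ebump; case: ifP => // t0.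
by rewrite mul1r expR_le1 oppr_le0 invr_ge0 ltW.
Qed.

(** With s = 1/t this is (s/(m+2))^(m+2) <= e^s, the (m+2)-th power of x <= e^x. The decay of second
    order makes the derivative at 0 vanish. *)
Lemma ebump_le m t : ebump m t <= (m.+2)%:R ^+ m.+2 * t ^+ 2.
Proof.
rewrite /ebump; case: ifP => t0; last first.
  by apply: mulr_ge0; [exact: exprn_ge0|exact: sqr_ge0].
set s := t^-1; have s0 : 0 < s by rewrite invr_gt0.
have -> : t = s^-1 by rewrite invrK.
have h : (s / m.+2%:R) ^+ m.+2 <= expR s.
  have sE : s = m.+2%:R * (s / m.+2%:R) by rewrite mulrC divfK// pnatr_eq0.
  rewrite {2}sE expRM_natl; apply: lerXn2r; rewrite ?nnegrE ?expR_ge0 ?divr_ge0 ?ltW//.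
  by apply: lt_le_trans (expR_ge1Dx _); rewrite ltrDr.
rewrite expRN ler_pdivrMr ?expR_gt0//.
move: h; rewrite expr_div_n ler_pdivrMr ?exprn_gt0// => h.
rewrite [s^-1 ^+ 2]exprVn mulrAC ler_pdivlMr ?exprn_gt0// -exprD addn2 mulrC//.
Qed.

Lemma is_derive_ebump m (t : R) :
  is_derive t 1 (ebump m) (- m%:R * ebump m.+1 t + ebump m.+2 t).
Proof.
have [t0|t0|<-] := ltgtP 0 t; last first.
- rewrite {2 3}/ebump ltxx mulr0 addr0; apply: is_derive_cvg.
  set C : R := (m.+2)%:R ^+ m.+2.
  apply/cvgr0Pnorm_le => e e0; near=> h.
  have h0 : h != 0 by near: h; exact: nbhs_dnbhs_neq.
  rewrite /GRing.scale/= mulr1 addr0 {2}/ebump ltxx subr0 normrM.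
  rewrite (ger0_norm (ebump_ge0 _ _)) normfV.
  rewrite mulrC ler_pdivrMr ?normr_gt0//.
  apply: le_trans (ebump_le _ _) _; rewrite -/C.
  rewrite -(real_normK (num_real h)) expr2 mulrA ler_wpM2r//.
  rewrite mulrC -ler_pdivlMr ?exprn_gt0//.
  by near: h; apply: dnbhs0_le; rewrite divr_gt0 ?exprn_gt0.
- rewrite /ebump; rewrite !(lt_gtF t0) mulr0 addr0.
  apply: (@near_eq_is_derive _ _ _ (fun=> 0)).
  have : \forall u \near t, u < 0 by exact: lt_nbhsl.
  by apply: filterS => u u0; rewrite (lt_gtF u0).
- have tn0 : t != 0 by rewrite gt_eqF.
  have iV : is_derive t 1 (fun u : R => u^-1) (- t ^- 2).
    have := @is_deriveV R id t 1 1 tn0 (is_derive_id _ _).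
    by rewrite /GRing.scale/= mulr1.
  have iX := is_deriveX m iV.
  have iN : is_derive t 1 (fun u : R => - u^-1) (- - t ^- 2) := is_deriveN iV.
  have iE : is_derive t 1 (expR \o (fun u : R => - u^-1)) (expR (- t^-1) * - - t ^- 2).
    exact: is_derive1_comp.
  have iM := is_deriveM iX iE.
  apply: (@near_eq_is_derive _ _ _ ((fun u : R => u^-1) ^+ m *
     (expR \o (fun u : R => - u^-1)))).
    have : \forall u \near t, 0 < u by exact: lt_nbhsr.
    by apply: filterS => u u0; rewrite /ebump u0 /= !fctE.
  apply: is_derive_eq iM _; rewrite /ebump t0 /= !fctE /GRing.scale/=.
  rewrite -exprVn; set s := t^-1; clear iX iE iN iV; case: m => [|m];
    rewrite ?mul0r ?expr0 /= !exprS; ring.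
Unshelve. all: by end_near. Qed.

Lemma continuous_ebump m : continuous (ebump m).
Proof.
move=> t; apply: differentiable_continuous; apply/derivable1_diffP.
by case: (is_derive_ebump m t).
Qed.

Lemma Cn_ebump d n m (i : 'I_d) (a b : R) :
  Cn n setT (fun x : 'rV[R]_d => ebump m (a * x 0 i + b)).
Proof.
have cont k : forall x : 'rV[R]_d, setT x ->
    {for x, continuous (fun x : 'rV[R]_d => ebump k (a * x 0 i + b))}.
  move=> x _.
  have H : (fun x : 'rV[R]_d => a * x 0 i + b) @ x --> a * x 0 i + b.
    exact: (cvgD (cvgM (cvg_cst a) (@coord_continuous _ _ _ 0 i x)) (cvg_cst b)).
  apply: (@cvg_comp _ _ _ (fun x : 'rV[R]_d => a * x 0 i + b) (ebump k) _ _ _ H).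
  exact: continuous_ebump.
elim: n m => [|n IH] m; first by split => //; exact: cont.
apply: (@Cn_succ _ _ _ openT _ _ (fun j x => ((i == j)%:R * a) *
  (- m%:R * ebump m.+1 (a * x 0 i + b) + ebump m.+2 (a * x 0 i + b)))).
- by move=> x _; exact: cont.
- move=> j x _; apply: is_derive_line.
  have -> : (fun h : R => ebump m (a * (h *: evec R j + x) 0 i + b)) =
    ebump m \o (fun h : R => h * ((i == j)%:R * a) + (a * x 0 i + b)).
    by apply/funext => h /=; rewrite !mxE eqxx/=; congr ebump; ring.
  rewrite [X in is_derive _ _ _ X]mulrC; apply: is_derive1_comp.
    by rewrite mul0r add0r; exact: is_derive_ebump.
  have := is_deriveD (is_deriveM (is_derive_id (0:R) 1)
    (is_derive_cst ((i == j)%:R * a) (0:R) 1)) (is_derive_cst (a * x 0 i + b) (0:R) 1).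
  rewrite scale0r add0r addr0 (_ : _%:A = (i == j)%:R * a); last exact: mulr1.
  exact.
move=> j; apply: Cn_mul; first exact: openT; first exact: Cn_cst openT _ _.
apply: Cn_add; [exact: openT| |exact: IH].
by apply: Cn_mul; [exact: openT|exact: Cn_cst openT _ _|exact: IH].
Qed.

Section tbump_fun.
Variable d : nat.
Local Notation V := 'rV[R]_d.
Variables (c c' : R) (a b : V).

(** The rates [c] and [c'] sharpen the lower and the upper faces separately. The upper faces need a
    faster rate later, because they will move towards their limit while the bump sharpens. *)
Definition tbump (x : V) : R := \prod_(i < d)
  (ebump 0 (c * x 0 i + - (c * a 0 i)) * ebump 0 (- c' * x 0 i + c' * b 0 i)).

Lemma Cn_tbump m : Cn m setT tbump.
Proof.
apply: Cn_prod; first exact: openT.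
by move=> i _; apply: Cn_mul; [exact: openT|exact: Cn_ebump|exact: Cn_ebump].
Qed.

Lemma tbump_ge0 x : 0 <= tbump x.
Proof. by apply: prodr_ge0 => i _; rewrite mulr_ge0// ebump_ge0. Qed.

Lemma tbump_le1 x : tbump x <= 1.
Proof.
suff : 0 <= tbump x <= 1 by case/andP.
rewrite /tbump; elim/big_ind: _ => [|u v /andP[u0 u1] /andP[v0 v1]|i _].
- by rewrite ler01 lexx.
- by rewrite mulr_ge0//= mulr_ile1.
- by rewrite mulr_ge0 ?ebump_ge0//= mulr_ile1 ?ebump_ge0 ?ebump0_le1.
Qed.

Hypotheses (c0 : 0 < c) (c'0 : 0 < c').

Lemma tbump_neq0 x : tbump x != 0 -> forall i, a 0 i < x 0 i < b 0 i.
Proof.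
move=> /prodf_neq0 h i; have := h i isT; rewrite mulf_eq0 negb_or => /andP[].
rewrite /ebump -mulrBr pmulr_rgt0// subr_gt0.
case: ifP => [ax _|_]; last by rewrite eqxx.
rewrite mulNr addrC -mulrBr pmulr_rgt0// subr_gt0.
by case: ifP => // _; rewrite eqxx.
Qed.

Lemma compact_box : compact (box a b).
Proof.
have := @rV_compact R d (fun i => `[a 0 i, b 0 i]%classic)
  (fun i => @segment_compact R (a 0 i) (b 0 i)).
by congr compact; apply/seteqP; split => x /= h i; have := h i; rewrite /= in_itv.
Qed.

Lemma closed_box : closed (box a b).
Proof. by apply: compact_closed compact_box; exact: norm_hausdorff. Qed.

Lemma test_fun_tbump (D : set V) : box a b `<=` D -> test_fun D tbump.
Proof.
move=> abD; have S : closure [set x | tbump x != 0] `<=` box a b.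
  apply: (subset_trans _ closed_box).
  by apply: closure_subset => x /= /tbump_neq0 h i; have /andP[/ltW -> /ltW ->] := h i.
split; first by apply/smooth_onP => m; exact: Cn_tbump.
split; last exact: subset_trans S abD.
apply: (@subclosed_compact _ _ (box a b)) => //; [exact: closed_closure|exact: compact_box].
Qed.

End tbump_fun.

Lemma tbump_translate d c c' (a b z x : 'rV[R]_d) :
  tbump c c' (a + z) (b + z) x = tbump c c' a b (x - z).
Proof. by apply: eq_bigr => i _; rewrite !mxE; congr (ebump _ _ * ebump _ _); ring. Qed.

End tbump.

(** * Minors and exterior powers *)

Section kidx_theory.
Variables (n k : nat).
Implicit Types S T : ksub n k.

Lemma kidx_inj S : injective (kidx S).
Proof. by move=> a b /enum_val_inj /cast_ord_inj. Qed.

Lemma kidx_mem S a : kidx S a \in val S.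
Proof. exact: enum_valP. Qed.

Lemma kidx_surj S x : x \in val S -> exists a, kidx S a = x.
Proof.
move=> xS; exists (cast_ord (eqP (valP S)) (enum_rank_in xS x)).
by rewrite /kidx cast_ordK enum_rankK_in.
Qed.

Lemma inj_kidx (f : 'I_k -> 'I_n) : injective f ->
  exists S (s : {perm 'I_k}), forall a, f a = kidx S (s a).
Proof.
move=> fi.
have cS : #|[set f a | a in 'I_k]%SET| == k by rewrite card_imset// card_ord.
pose S : ksub n k := exist (fun S : {set 'I_n} => #|S| == k) _ cS; exists S.
have /fin_all_exists[g gE] a : exists b, kidx S b = f a.
  by apply: kidx_surj; exact: imset_f.
have gi : injective g by move=> a b ab; apply: fi; rewrite -!gE ab.
by exists (perm gi) => a; rewrite permE gE.
Qed.

Lemma ksub_exists (A : {set 'I_n}) : (k <= #|A|)%N ->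
  exists S : ksub n k, val S \subset A.
Proof.
move=> kA.
have cS : #|[set x in take k (enum A)]%SET| == k.
  rewrite cardsE (card_uniqP _) ?take_uniq ?enum_uniq// size_take -cardE.
  by case: ltngtP kA => // ->.
exists (exist (fun S : {set 'I_n} => #|S| == k) _ cS); apply/fintype.subsetP => x /=.
by rewrite inE => /mem_take; rewrite mem_enum.
Qed.

Lemma ksub_avoid (q : 'I_n) : (k <= n.-1)%N -> exists S : ksub n k, q \notin val S.
Proof.
move=> kn; have [|S SA] := @ksub_exists (~: [set q])%SET.
  by rewrite cardsC1 card_ord.
by exists S; apply/negP => /(fintype.subsetP SA); rewrite !inE eqxx.
Qed.

End kidx_theory.

Lemma ksub_contain (n k : nat) (q : 'I_n) : (0 < k <= n)%N ->
  exists S : ksub n k, q \in val S.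
Proof.
case: k => // k /= kn.
have [|S qS] := @ksub_avoid n k q; first by case: n q kn => // n q; rewrite ltnS.
have cS : #|(q |: val S)%SET| == k.+1 by rewrite cardsU1 qS (eqP (valP S)).
by exists (exist (fun S : {set 'I_n} => #|S| == k.+1) _ cS); rewrite /= !inE eqxx.
Qed.

Section minors.
Variable R : comRingType.

Definition minor n k (A : 'M[R]_n) (f g : 'I_k -> 'I_n) : R :=
  \det (\matrix_(a, b) A (f a) (g b)).

Lemma extpowE n k (A : 'M[R]_n) I J :
  extpow k A I J = minor A (kidx (enum_val I)) (kidx (enum_val J)).
Proof. by rewrite mxE. Qed.

(** Multilinearity in the rows: each row of the product is a combination of the rows of [Y], and [f]
    records which row is picked. *)
Lemma det_mulmx_ffun n k (X : 'M[R]_(k, n)) (Y : 'M[R]_(n, k)) :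
  \det (X *m Y) = \sum_(f : {ffun 'I_k -> 'I_n})
     (\prod_a X a (f a)) * \det (\matrix_(a, b) Y (f a) b).
Proof.
rewrite /determinant (eq_bigr (fun s : {perm 'I_k} => \sum_(f : {ffun 'I_k -> 'I_n})
    (-1) ^+ s * \prod_a (X a (f a) * Y (f a) (s a)))); last first.
  move=> s _; rewrite -big_distrr/=; congr (_ * _).
  rewrite (eq_bigr (fun i => \sum_j X i j * Y j (s i))); last by move=> i _; rewrite mxE.
  by rewrite bigA_distr_bigA.
rewrite exchange_big/=; apply: eq_bigr => f _.
rewrite big_distrr/=; apply: eq_bigr => s _.
rewrite big_split/= mulrCA; congr (_ * (_ * _)).
by apply: eq_bigr => i _; rewrite mxE.
Qed.

Lemma det_rows_perm k (M : 'M[R]_k) (s : {perm 'I_k}) :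
  \det (\matrix_(a, b) M (s a) b) = (-1) ^+ s * \det M.
Proof.
rewrite -det_perm -det_mulmx -row_permE; congr (\det _).
by apply/matrixP => a b; rewrite !mxE.
Qed.

Lemma det_cols_perm k (M : 'M[R]_k) (s : {perm 'I_k}) :
  \det (\matrix_(a, b) M a (s b)) = (-1) ^+ s * \det M.
Proof.
rewrite -det_tr -[in RHS]det_tr -det_rows_perm; congr (\det _).
by apply/matrixP => a b; rewrite !mxE.
Qed.

(** In [det_mulmx_ffun] the maps that are not injective give determinants with a repeated row. An
    injective map is a k-subset together with a permutation, and the sum over permutations is the
    determinant of the columns of [X] in that subset. *)
Lemma cauchy_binet n k (X : 'M[R]_(k, n)) (Y : 'M[R]_(n, k)) :
  \det (X *m Y) = \sum_(S : ksub n k)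
   \det (\matrix_(a, b) X a (kidx S b)) * \det (\matrix_(a, b) Y (kidx S a) b).
Proof.
rewrite det_mulmx_ffun (bigID (fun f : {ffun 'I_k -> 'I_n} => injectiveb f))/=.
rewrite [X in _ + X]big1 ?addr0; last first.
  move=> f /injectivePn[a [b ab fab]].
  by rewrite (determinant_alternate ab) ?mulr0// => j; rewrite !mxE fab.
pose h (p : ksub n k * {perm 'I_k}) := [ffun a => kidx p.1 (p.2 a)] : {ffun 'I_k -> 'I_n}.
have hi : {in [set: ksub n k * {perm 'I_k}]%SET &, injective h}.
  move=> [S s] [T t] _ _ /ffunP hE.
  have ST : S = T.
    apply/val_inj/setP => x; apply/idP/idP => /kidx_surj[a <-].
      by have := hE (s^-1%g a); rewrite !ffunE /= permKV => ->; exact: kidx_mem.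
    by have := hE (t^-1%g a); rewrite !ffunE /= permKV => <-; exact: kidx_mem.
  congr (_, _) => //; subst T; apply/permP => a.
  by have := hE a; rewrite !ffunE /= => /kidx_inj.
rewrite (eq_bigl (mem (h @: [set: ksub n k * {perm 'I_k}])%SET)); last first.
  move=> f /=; apply/idP/idP => [/injectiveP /inj_kidx[S [s fE]]|].
    by apply/imsetP; exists (S, s); [rewrite inE|apply/ffunP => a; rewrite ffunE fE].
  move=> /imsetP[[S s] _ ->]; apply/injectiveP => a b; rewrite !ffunE/=.
  by move=> /kidx_inj /perm_inj.
rewrite big_imset//= (eq_bigl xpredT); last by move=> p; rewrite inE.
rewrite -(pair_bigA _ (fun S s => (\prod_a X a (h (S, s) a)) *
   \det (\matrix_(a, b) Y (h (S, s) a) b)))/=.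
apply: eq_bigr => S _; rewrite [in RHS]/determinant big_distrl/=.
apply: eq_bigr => s _.
rewrite [X in _ * X](_ : _ = (-1) ^+ s * \det (\matrix_(a, b) Y (kidx S a) b)).
  rewrite mulrCA mulrA; congr (_ * _ * _).
  by apply: eq_bigr => a _; rewrite !mxE ffunE.
rewrite -det_rows_perm; congr (\det _).
by apply/matrixP => a b; rewrite !mxE ffunE.
Qed.

Lemma extpow_mul n k (A B : 'M[R]_n) : extpow k (A *m B) = extpow k A *m extpow k B.
Proof.
apply/matrixP => I K; rewrite [RHS]mxE.
under eq_bigr do rewrite !extpowE.
rewrite -(big_enum_val (A := predT) (fun S => minor A (kidx (enum_val I)) (kidx S) *
   minor B (kidx S) (kidx (enum_val K))))/=.
rewrite extpowE /minor.
rewrite (_ : \matrix_(a, b) _ = (\matrix_(a, j) A (kidx (enum_val I) a) j) *m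
  (\matrix_(j, b) B j (kidx (enum_val K) b))); last first.
  by apply/matrixP => a b; rewrite !mxE; apply: eq_bigr => j _; rewrite !mxE.
rewrite cauchy_binet; apply: eq_bigr => S _.
by congr (_ * _); congr (\det _); apply/matrixP => a b; rewrite !mxE.
Qed.

Lemma minor_inj n k (f g : 'I_k -> 'I_n) : injective f -> injective g ->
  exists (s : bool) I J, forall A : 'M[R]_n, minor A f g = (-1) ^+ s * extpow k A I J.
Proof.
move=> /inj_kidx[S [s fE]] /inj_kidx[T [t gE]].
exists (s (+) t), (enum_rank S), (enum_rank T) => A.
rewrite extpowE !enum_rankK /minor signr_addb -mulrA -det_cols_perm -det_rows_perm.
by congr (\det _); apply/matrixP => a b; rewrite !mxE fE gE.
Qed.

(* A one-row perturbation of a submatrix of the identity: the product of a lower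
   and an upper triangular matrix. *)
Lemma minor_rank1 n k (v w : 'I_n -> R) (f g : 'I_k.+1 -> 'I_n) :
  injective f -> injective g -> (forall a, a != ord0 -> f a = g a) ->
  f ord0 != g ord0 ->
  minor (\matrix_(i, j) ((i == j)%:R + v i * w j)) f g = v (f ord0) * w (g ord0).
Proof.
move=> fi gi fg fg0.
pose T : 'M[R]_k.+1 := \matrix_(a, b)
  ((b == ord0)%:R * v (f a) + ((a == b) && (a != ord0))%:R).
pose N : 'M[R]_k.+1 := \matrix_(a, b)
  if a == ord0 then w (g b) else (a == b)%:R.
have -> : minor (\matrix_(i, j) ((i == j)%:R + v i * w j)) f g = \det (T *m N).
  congr (\det _); apply/matrixP => a b; rewrite !mxE.
  rewrite (bigD1 ord0)//= !mxE eqxx mul1r.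
  have [->|a0] := eqVneq a ord0.
    rewrite andbF addr0 big1 ?addr0; last first.
      move=> c c0; rewrite !mxE (negbTE c0) eq_sym (negbTE c0)/=.
      by rewrite mul0r addr0 mul0r.
    rewrite (_ : f ord0 == g b = false) ?add0r//; apply/negbTE.
    have [->//|b0] := eqVneq b ord0.
    by rewrite -(fg b b0) (inj_eq fi) eq_sym.
  rewrite /= addr0 (bigD1 a)//= !mxE (negbTE a0) eqxx/=.
  rewrite mul0r add0r mul1r big1 ?addr0; last first.
    move=> c /andP[c0 ca]; rewrite !mxE (negbTE c0) eq_sym (negbTE ca)/=.
    by rewrite mul0r addr0 mul0r.
  by rewrite addrC (fg a a0) (inj_eq gi).
rewrite det_mulmx det_trig; last first.
  apply/is_trig_mxP => a b ab; rewrite mxE.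
  have b0 : b != ord0 by rewrite -val_eqE/= -lt0n (leq_ltn_trans _ ab).
  by rewrite (negbTE b0) mul0r add0r (_ : a == b = false)//;
    apply/negbTE; rewrite -val_eqE/= neq_ltn ab.
rewrite -[\det N]det_tr det_trig; last first.
  apply/is_trig_mxP => a b ab; rewrite !mxE.
  have b0 : b != ord0 by rewrite -val_eqE/= -lt0n (leq_ltn_trans _ ab).
  by rewrite (negbTE b0) (_ : b == a = false)//; apply/negbTE; rewrite -val_eqE/= neq_ltn ab orbT.
rewrite !(bigD1 (P := xpredT) ord0)//= !big1 ?mulr1; last 2 first.
- by move=> a a0; rewrite !mxE (negbTE a0) eqxx.
- by move=> a a0; rewrite !mxE (negbTE a0) eqxx /= mul0r add0r.
by rewrite !mxE eqxx /= mul1r addr0.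
Qed.

(* The remaining k - 1 indices are shared by both minors and avoid p and q. *)
Lemma minor_pair n k (p q : 'I_n) : p != q -> (0 < k <= n.-1)%N ->
  exists (s : bool) I J, forall v w : 'I_n -> R,
   v p * w q = (-1) ^+ s * extpow k (\matrix_(i, j) ((i == j)%:R + v i * w j)) I J.
Proof.
case: k => // k pq /= kn.
have [|S SA] := @ksub_exists n k (~: [set p; q])%SET.
  have := cardsC [set p; q]%SET; rewrite cards2 pq card_ord /= => E.
  suff : (k < (2 + #|(~: [set p; q])%SET|).-1)%N by [].
  by rewrite E.
have pS a : kidx S a != p.
  by apply/negP => /eqP E; have /(fintype.subsetP SA) := kidx_mem S a; rewrite E !inE eqxx.
have qS a : kidx S a != q.
  by apply/negP => /eqP E; have /(fintype.subsetP SA) := kidx_mem S a; rewrite E !inE eqxx orbT.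
pose F (r : 'I_n) (a : 'I_k.+1) : 'I_n := if unlift ord0 a is Some b then kidx S b else r.
have Fi r : (forall a, kidx S a != r) -> injective (F r).
  move=> rS a b; rewrite /F.
  case: (unliftP ord0 a) => [a' ->|->]; case: (unliftP ord0 b) => [b' ->|->] //.
  - by move=> /kidx_inj ->.
  - by move=> E; have := rS a'; rewrite E eqxx.
  - by move=> E; have := rS b'; rewrite -E eqxx.
have F0 r : F r ord0 = r by rewrite /F unlift_none.
have [s [I [J h]]] := minor_inj (Fi p pS) (Fi q qS).
exists s, I, J => v w.
rewrite -h minor_rank1 ?F0//; [exact: Fi|exact: Fi|].
move=> a a0; rewrite /F; case: (unliftP ord0 a) => // a0'.
by rewrite a0' eqxx in a0.
Qed.

End minors.

Section extpow_field.
Variables (F : fieldType) (n k : nat).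
Implicit Types A : 'M[F]_n.

Lemma extpow1 : extpow k (1%:M : 'M[F]_n) = 1%:M.
Proof.
apply/matrixP => I J; rewrite extpowE mxE.
have [->|IJ] := eqVneq I J.
  rewrite /minor (_ : \matrix_(_, _) _ = 1%:M) ?det1//.
  by apply/matrixP => a b; rewrite !mxE (inj_eq (@kidx_inj _ _ _)).
suff [a ha] : exists a, kidx (enum_val I) a \notin val (enum_val J).
  rewrite /minor (expand_det_row _ a) big1// => b _; rewrite !mxE.
  rewrite (_ : _ == _ = false) ?mul0r//; apply/negbTE; apply: contra ha => /eqP ->.
  exact: kidx_mem.
have : ~~ (val (enum_val I) \subset val (enum_val J)).
  apply: contra IJ => IJ; apply/eqP/enum_val_inj/val_inj/eqP.
  by rewrite eqEcard IJ (eqP (valP (enum_val I))) (eqP (valP (enum_val J)))/=.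
by case/fintype.subsetPn => x /kidx_surj[a <-] ha; exists a.
Qed.

Lemma extpow_invmx A : A \in unitmx ->
  extpow k A \in unitmx /\ extpow k (invmx A) = invmx (extpow k A).
Proof.
move=> uA; have E : extpow k A *m extpow k (invmx A) = 1%:M.
  by rewrite -extpow_mul mulmxV// extpow1.
have [u _] := mulmx1_unit E; split => //.
by rewrite -[LHS](mulKmx u) E mulmx1.
Qed.

(** Up to invertible factors A is the rank normal form. If the rank is not full, its last row is
    zero, hence so is the row of its exterior power at any k-subset containing the last index, and
    such a subset exists because k > 0. *)
Lemma extpow_unit A : (0 < k <= n)%N -> extpow k A \in unitmx -> A \in unitmx.
Proof.
move=> kn uW; rewrite -row_free_unit /row_free eqn_leq rank_leq_row leqNgt /=.
apply/negP => rn; move: uW; rewrite -(mulmx_ebase A) !extpow_mul !unitmx_mul.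
case/andP => /andP[_]; set W := extpow k (pid_mx _) => uW _.
have nn : (n.-1 < n)%N by rewrite prednK//; exact: leq_ltn_trans rn.
have [S mS] := ksub_contain (Ordinal nn) kn.
have [a aE] := kidx_surj mS.
have W0 : row (enum_rank S) W = 0.
  apply/rowP => J; rewrite !mxE; rewrite (expand_det_row _ a) big1// => b _.
  rewrite !mxE enum_rankK aE/=.
  rewrite (_ : (n.-1 < \rank A)%N = false) ?andbF ?mul0r//; apply/negbTE.
  by rewrite -leqNgt -ltnS prednK//; exact: leq_ltn_trans rn.
have : delta_mx 0 (enum_rank S) *m W *m invmx W = 0 :> 'rV_#|{: ksub n k}|.
  by rewrite -rowE W0 mul0mx.
rewrite mulmxK// => /matrixP/(_ 0 (enum_rank S)); rewrite !mxE !eqxx => /eqP.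
by rewrite oner_eq0.
Qed.

(* A (1 + E_ij) A^-1 = 1 + (column i of A) (row j of A^-1), so that this product
   of entries is an entry of a product of W, W^-1 and a constant matrix. *)
Lemma entry_pair (p q : 'I_n) : p != q -> (0 < k <= n.-1)%N ->
  exists (s : bool) I J, forall A i j, A \in unitmx ->
   A p i * invmx A j q = (-1) ^+ s *
     (extpow k A *m extpow k (1%:M + delta_mx i j) *m invmx (extpow k A)) I J.
Proof.
move=> pq kn; have [s [I [J h]]] := minor_pair F pq kn.
exists s, I, J => A i j uA.
rewrite (h (fun p => A p i) (fun q => invmx A j q)).
have [_ <-] := extpow_invmx uA; rewrite -!extpow_mul.
congr (_ * extpow k _ I J).
rewrite mulmxDr mulmx1 mulmxDl mulmxV//; apply/matrixP => a b.
rewrite !mxE; congr (_ + _).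
rewrite (bigD1 j)//= big1 ?addr0; last first.
  move=> c cj; rewrite !mxE big1 ?mul0r// => e _.
  by rewrite !mxE (negbTE cj) andbF mulr0.
rewrite !mxE (bigD1 i)//= big1 ?addr0; last first.
  by move=> c ci; rewrite !mxE (negbTE ci) mulr0.
by rewrite !mxE !eqxx mulr1.
Qed.

End extpow_field.

(** * Recovering a continuous matrix field from its smooth exterior power *)

Section smooth_matrix.
Variables (R : realType) (d : nat).
Local Notation V := 'rV[R]_d.

Lemma continuous_entry N (G : V -> 'M[R]_N) (x : V) a b :
  {for x, continuous G} -> {for x, continuous (fun y => G y a b)}.
Proof.
move=> Gc; apply: (@cvg_comp _ _ _ G (fun A : 'M[R]_N => A a b) _ _ _ Gc).
exact: coord_continuous.
Qed.

Definition mxCn N m (D : set V) (A : V -> 'M[R]_N) : Prop :=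
  forall I J, Cn m D (fun x => A x I J).

Section open_domain.
Variable D : set V.
Hypothesis oD : open D.

Lemma mxCn_mul N m (A B : V -> 'M[R]_N) : mxCn m D A -> mxCn m D B ->
  mxCn m D (fun x => A x *m B x).
Proof.
move=> AC BC I J; apply: (@Cn_eq _ _ _ oD m (fun x => \sum_j A x I j * B x j J)).
  by move=> x _; rewrite mxE.
by apply: Cn_sum => // j _; apply: Cn_mul.
Qed.

Lemma mxCn_cst N m (A : 'M[R]_N) : mxCn m D (fun=> A).
Proof. by move=> I J; exact: Cn_cst. Qed.

Lemma Cn_det N m (A : V -> 'M[R]_N) : mxCn m D A -> Cn m D (fun x => \det (A x)).
Proof.
move=> AC; apply: Cn_sum => // s _; apply: Cn_mul => //; first exact: Cn_cst.
by apply: Cn_prod => // i _; exact: AC.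
Qed.

Lemma mxCn_inv N m (A : V -> 'M[R]_N) : (forall x, D x -> A x \in unitmx) ->
  mxCn m D A -> mxCn m D (fun x => invmx (A x)).
Proof.
move=> uA AC I J.
apply: (@Cn_eq _ _ _ oD m (fun x => (\det (A x))^-1 * ((-1) ^+ (J + I) *
    \det (row' J (col' I (A x)))))).
  by move=> x Dx; rewrite /invmx uA// !mxE.
apply: Cn_mul => //.
  apply: Cn_inv => //; last exact: Cn_det.
  by move=> x Dx; rewrite -unitfE; have := uA x Dx; rewrite unitmxE.
apply: Cn_mul => //; first exact: Cn_cst.
apply: Cn_det => a b; apply: (@Cn_eq _ _ _ oD m (fun x => A x (lift J a) (lift I b))) => //.
by move=> x _; rewrite !mxE.
Qed.

End open_domain.

(* The entries [G p i * invmx G j q] with [p != q] are smooth functions of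
   [extpow k G], hence so is a k-th power of [invmx G j q], by rescaling a minor
   of [G] whose rows avoid [q]. *)
Lemma smooth_extpow_root k (D : set V) (G : V -> 'M[R]_d)
    (W : V -> 'M[R]_#|{: ksub d k}|) :
  open D -> (0 < k <= d.-1)%N ->
  (forall x, D x -> {for x, continuous G}) ->
  (forall I J, smooth_on D (fun x => W x I J)) ->
  (forall x, D x -> W x \in unitmx) ->
  (forall x, D x -> W x = extpow k (G x)) ->
  forall i j, smooth_on D (fun x => G x i j).
Proof.
move=> oD kd Gc WS uW WG p i.
have kd' : (0 < k <= d)%N.
  by have /andP[-> h] := kd; exact: leq_trans h (leq_pred _).
have WC m : mxCn m D W by move=> I J; have /smooth_onP := WS I J; exact.
have uG x : D x -> G x \in unitmx.
  by move=> Dx; apply: (extpow_unit kd'); rewrite -WG// uW.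
have GC0 : mxCn 0 D G.
  by move=> a b; split=> // x Dx; exact: continuous_entry (Gc x Dx).
pose B x := invmx (G x).
have BC0 : mxCn 0 D B by exact: mxCn_inv.
have pairC p' q j i' m : p' != q -> Cn m D (fun x => G x p' i' * B x j q).
  move=> pq; have [s [I [J h]]] := entry_pair R pq kd.
  apply: (@Cn_eq _ _ _ oD m (fun x => (-1) ^+ s *
    (W x *m extpow k (1%:M + delta_mx i' j) *m invmx (W x)) I J)).
    by move=> x Dx; rewrite h ?uG// -WG.
  apply: Cn_mul => //; first exact: Cn_cst.
  apply: mxCn_mul => //; last exact: mxCn_inv.
  by apply: mxCn_mul => //; exact: mxCn_cst.
apply: smooth_on_local => x0 Dx0.
(* The column [q] is chosen after the row [p] of the wanted entry; this is how all rows are reached.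
   Two indices exist because 0 < k <= d - 1. *)
have [q qp] : exists q, q != p.
  have d1 : (1 < d)%N by case: (d) kd => [|[|]]//; case: (k).
  have [pz|pz] := eqVneq p (Ordinal (ltnW d1)).
    by exists (Ordinal d1); rewrite pz.
  by exists (Ordinal (ltnW d1)); rewrite eq_sym.
have [j Bj] : exists j, B x0 j q != 0.
  apply: contrapT => /forallNP h.
  have : (G x0 *m B x0) q q = 1 by rewrite mulmxV ?uG// mxE eqxx.
  rewrite mxE big1 => [/eqP|j _]; first by rewrite eq_sym oner_eq0.
  by have /negP := h j; rewrite negbK => /eqP ->; rewrite mulr0.
have [S qS] : exists S : ksub d k, q \notin val S by apply: ksub_avoid; case/andP: kd.
pose I := enum_rank S.
have [J WJ] : exists J, W x0 I J != 0.
  apply: contrapT => /forallNP h.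
  have : (W x0 *m invmx (W x0)) I I = 1 by rewrite mulmxV ?uW// mxE eqxx.
  rewrite mxE big1 => [/eqP|J _]; first by rewrite eq_sym oner_eq0.
  by have /negP := h J; rewrite negbK => /eqP ->; rewrite mul0r.
have [U [oU Ux0] UP] : exists2 U, open_nbhs x0 U &
    U `<=` [set x | [/\ D x, B x j q != 0 & W x I J != 0]].
  have : nbhs x0 [set x | [/\ D x, B x j q != 0 & W x I J != 0]].
    near=> x; split; near: x.
    - exact: open_nbhs_nbhs.
    - apply: (continuous_near_neq0 (f := fun x => B x j q)) => //.
      exact: Cn_cont (BC0 j q) x0 Dx0.
    - apply: (continuous_near_neq0 (f := fun x => W x I J)) => //.
      exact: Cn_cont (WC 0%N I J) x0 Dx0.
  by rewrite nbhsE.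
exists U => //; apply/smooth_onP => m.
have UD : U `<=` D by move=> x /UP[].
have sub (g : V -> R) : Cn m D g -> Cn m U g.
  elim: m g {WC pairC} => [|m IH] g [gc h]; first by split => // x /UD; exact: gc.
  split=> [x /UD|a]; first exact: gc.
  by have [hd hC] := h a; split; [move=> x /UD; exact: hd|exact: IH].
have BC : Cn m U (fun x => B x j q).
  apply: (@Cn_root _ _ _ oU k) => //.
  - by case/andP: kd.
  - by move=> x /UD Dx; exact: Cn_cont (BC0 j q) x Dx.
  - by move=> x /UP[].
  pose M x := \matrix_(a < k, b < k)
    (G x (kidx S a) (kidx (enum_val J) b) * B x j q).
  apply: (@Cn_eq _ _ _ oU m (fun x => \det (M x) * (W x I J)^-1)).
    move=> x /UP[Dx _ WIJ].
    rewrite WG// extpowE enum_rankK in WIJ *.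
    rewrite (_ : M x = B x j q *: \matrix_(a, b) G x (kidx S a) (kidx (enum_val J) b)).
      by rewrite detZ mulfK.
    by apply/matrixP => a b; rewrite !mxE mulrC.
  apply: Cn_mul => //; last first.
    by apply: Cn_inv => //; [move=> x /UP[]|apply: sub; exact: WC].
  apply: Cn_det => // a b.
  apply: (@Cn_eq _ _ _ oU m (fun x => G x (kidx S a) (kidx (enum_val J) b) * B x j q)).
    by move=> x _; rewrite mxE.
  apply: sub; apply: pairC; apply: contraNneq qS => <-; exact: kidx_mem.
apply: (@Cn_eq _ _ _ oU m (fun x => (G x p i * B x j q) * (B x j q)^-1)).
  by move=> x /UP[_ B0 _]; rewrite mulfK.
apply: Cn_mul => //; first by apply: sub; apply: pairC; rewrite eq_sym.
by apply: Cn_inv => // x /UP[].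
Unshelve. all: by end_near. Qed.

End smooth_matrix.

(** * Rules for the integral over sets of vectors *)

Section integral_interface.
Variables (R : realType) (n : nat).
Local Notation d := n.+1.
Local Notation V := 'rV[R]_d.
Local Notation U := (caratheodory_type (@lout R d)).
Local Notation mu := (@lebd R n).

(** The sigma-algebra lives on [caratheodory_type], a copy of the space of vectors. [Int], [Ig] and
    [mf] keep that copy out of later statements. *)
Definition Int (D : set V) (f : V -> R) : R := Rintegral mu (D : set U) (f : U -> R).

Definition Ig (D : set V) (f : V -> R) : Prop :=
  mu.-integrable (D : set U) (fun x => (f x)%:E).

Definition mf (D : set V) (f : V -> R) : Prop := measurable_fun (D : set U) (f : U -> R).

Implicit Types (D : set V) (f g : V -> R).

Lemma Ig_mf D f : Ig D f -> mf D f.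
Proof. by move=> h; apply/measurable_EFinP; exact: measurable_int h. Qed.

Lemma Int_eq D f g : (forall x, D x -> f x = g x) -> Int D f = Int D g.
Proof. by move=> fg; apply: eq_Rintegral => x /set_mem; exact: fg. Qed.

Lemma Ig_eq D f g : lmeas D -> (forall x, D x -> f x = g x) -> Ig D f -> Ig D g.
Proof.
move=> mD fg; apply: eq_integrable; first exact: mD.
by move=> x /set_mem Dx; rewrite fg.
Qed.

Lemma IgD D f g : lmeas D -> Ig D f -> Ig D g -> Ig D (fun x => f x + g x).
Proof. by move=> mD If IG; have := integrableD (mD : measurable (D : set U)) If IG. Qed.

Lemma IgZ D (c : R) f : lmeas D -> Ig D f -> Ig D (fun x => c * f x).
Proof. by move=> mD If; have := integrableZl (mD : measurable (D : set U)) c If. Qed.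

Lemma IgB D f g : lmeas D -> Ig D f -> Ig D g -> Ig D (fun x => f x - g x).
Proof.
move=> mD If IG; apply: (Ig_eq mD (f := fun x => f x + -1 * g x)).
  by move=> x _; rewrite mulN1r.
by apply: IgD => //; exact: IgZ.
Qed.

Lemma IntB D f g : lmeas D -> Ig D f -> Ig D g ->
  Int D (fun x => f x - g x) = Int D f - Int D g.
Proof. by move=> mD If IG; exact: (RintegralB (mD : measurable (D : set U)) If IG). Qed.

Lemma IntZ D (c : R) f : lmeas D -> Ig D f -> Int D (fun x => c * f x) = c * Int D f.
Proof. by move=> mD If; exact: (RintegralZl c (mD : measurable (D : set U)) If). Qed.

Lemma Int_le D f g : lmeas D -> Ig D f -> Ig D g -> (forall x, D x -> f x <= g x) ->
  Int D f <= Int D g.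
Proof. by move=> mD If IG fg; exact: (le_Rintegral (mD : measurable (D : set U)) If IG fg). Qed.

Lemma Int_cst D (c : R) : lmeas D -> Int D (fun=> c) = c * fine (lout D).
Proof. by move=> mD; exact: (Rintegral_cst mu (mD : measurable (D : set U)) c). Qed.

Lemma Int_setU A B f : lmeas A -> lmeas B -> Ig (A `|` B) f -> A `&` B = set0 ->
  Int (A `|` B) f = Int A f + Int B f.
Proof.
move=> mA mB If AB; apply: (Rintegral_setU (mA : measurable (A : set U)) mB If).
by apply/disj_set2P.
Qed.

Lemma IgS D K f : lmeas D -> lmeas K -> K `<=` D -> Ig D f -> Ig K f.
Proof. by move=> mD mK KD; apply: integrableS; [exact: mD|exact: mK|exact: KD]. Qed.

Lemma Int_restrict D K f : K `<=` D -> Int D (fun x => if x \in K then f x else 0) = Int K f.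
Proof.
move=> KD; rewrite /Int -[in RHS](setIidr KD) Rintegral_mkcondr.
by apply: eq_Rintegral => x _; rewrite patchE.
Qed.

Lemma mfM D f g : mf D f -> mf D g -> mf D (fun x => f x * g x).
Proof. exact: measurable_funM. Qed.

Lemma mfS D K f : lmeas D -> K `<=` D -> mf D f -> mf K f.
Proof. by move=> mD KD; apply: measurable_funS; [exact: mD|exact: KD]. Qed.

Lemma mf_continuous D f : open D -> (forall x, D x -> {for x, continuous f}) -> mf D f.
Proof.
move=> oD fc; apply/(lmeasfunP _ (lmeas_open oD)) => t; apply: lmeas_open.
rewrite openE => x [Dx tx]; apply: filterI; first exact: open_nbhs_nbhs.
have H : f @ x --> f x := fc x Dx.
exact: (cvgr_gt (f x) H).
Qed.

Lemma Ig_le D f g : lmeas D -> mf D f -> Ig D g -> (forall x, D x -> `|f x| <= `|g x|) -> Ig D f.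
Proof.
move=> mD mf_ IG fg; apply: (le_integrable (mD : measurable (D : set U)) _ _ IG).
  by apply/measurable_EFinP.
by move=> x Dx; rewrite /= lee_fin; exact: fg.
Qed.

Lemma Ig_cst D (c : R) : lmeas D -> (lout D < +oo)%E -> Ig D (fun=> c).
Proof.
move=> mD fD; apply/integrableP; split; first exact: measurable_cst.
rewrite (integral_cst mu (mD : measurable (D : set U)) `|c|%:E).
by apply: lte_mul_pinfty; rewrite ?lee_fin.
Qed.

Lemma Ig_bounded D f (M : R) : lmeas D -> (lout D < +oo)%E -> mf D f ->
  (forall x, D x -> `|f x| <= M) -> Ig D f.
Proof.
move=> mD fD mf_ fM; apply: (Ig_le mD mf_ (Ig_cst M mD fD)) => x Dx.
by apply: le_trans (fM x Dx) _; exact: ler_norm.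
Qed.

Lemma Ig_bdd_mul D f g (M : R) : lmeas D -> Ig D f -> mf D g ->
  (forall x, D x -> `|g x| <= M) -> Ig D (fun x => f x * g x).
Proof.
move=> mD If mg gM; apply: (Ig_le mD _ (IgZ M mD If)).
  by apply: mfM => //; exact: Ig_mf.
move=> x Dx; rewrite !normrM mulrC ler_wpM2r//.
by apply: le_trans (gM x Dx) _; exact: ler_norm.
Qed.

Lemma Int_dct D f g (F : nat -> V -> R) : lmeas D -> Ig D g -> Ig D f ->
  (forall k, mf D (F k)) -> (forall k x, D x -> `|F k x| <= `|g x|) ->
  (forall x, D x -> F ^~ x @ \oo --> f x) ->
  (fun k => Int D (F k)) @ \oo --> Int D f.
Proof.
move=> mD IG If mF Fg Ff; rewrite /Int /Rintegral.
apply: fine_cvg; rewrite fineK; last first.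
  by apply: integrable_fin_num => //; exact: mD.
apply: (@dominated_cvg _ U R mu D mD (fun k x => (F k x)%:E) (fun x => (f x)%:E)
   (fun x => `|g x|%:E)).
- by move=> k; apply/measurable_EFinP; exact: mF.
- move=> x Dx; apply: cvg_EFin; first exact: nearW.
  exact: Ff.
- by [].
- by have := integrable_abse IG.
- by move=> k x Dx; rewrite /= lee_fin; exact: Fg.
Qed.

Lemma Int_abs_le D f g : lmeas D -> Ig D f -> Ig D g ->
  (forall x, D x -> `|f x| <= g x) -> `|Int D f| <= Int D g.
Proof.
move=> mD If IG fg; rewrite ler_norml; apply/andP; split.
  rewrite -mulN1r -IntZ//; apply: Int_le => //; first exact: IgZ.
  by move=> x Dx; have := fg x Dx; rewrite ler_norml mulN1r => /andP[].
by apply: Int_le => // x Dx; apply: le_trans (fg x Dx); exact: ler_norm.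
Qed.

Lemma lint_Int D f : lmeas D -> Ig D f -> lint D f = Int D f.
Proof. exact: lintE. Qed.

Lemma lint_restrict D K f : K `<=` D -> (forall x, D x -> ~ K x -> f x = 0) ->
  lint D f = lint K f.
Proof.
move=> KD f0.
(* The scalars 1 and -1 give the positive and the negative part. *)
suff h (s : R) : lint_nn D (fun x => Num.max (s * f x) 0) =
                 lint_nn K (fun x => Num.max (s * f x) 0).
  rewrite /lint; congr (fine _ - fine _).
    by have := h 1; under eq_fun do rewrite mul1r.
  by have := h (-1); under eq_fun do rewrite mulN1r.
apply: eq_integral => t; rewrite inE/= in_itv/= andbT => t0.
congr lout; apply/seteqP; split=> x /= [Dx tx]; last by split => //; exact: KD.
split => //; apply: contrapT => /(f0 x Dx) fx0.
by move: tx; rewrite fx0 mulr0 maxxx ltNge t0.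
Qed.

Lemma lout_ae_le D (P Q : V -> Prop) : lout [set x | D x /\ ~ (P x -> Q x)] = 0%E ->
  (lout [set x | D x /\ P x] <= lout [set x | D x /\ Q x])%E.
Proof.
move=> N0; rewrite -[leRHS]adde0 -N0.
apply: le_trans (@outer_measureU2 _ _ (@lout R d) _ _).
apply: le_lout => x [Dx Px]; have [Qx|nQx] := pselect (Q x); [by left|right].
by split => // h; apply: nQx; exact: h.
Qed.

(** The level sets of both sides differ by null sets, so the layer-cake formula sees no difference;
    subadditivity of the outer measure suffices for this. *)
Lemma lint_ae D f g : ae_on D (fun x => f x = g x) -> lint D f = lint D g.
Proof.
move=> fg.
suff h (s : R) : lint_nn D (fun x => Num.max (s * f x) 0) =
                 lint_nn D (fun x => Num.max (s * g x) 0).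
  rewrite /lint; congr (fine _ - fine _).
    by have := h 1; under eq_fun do rewrite mul1r; under [in RHS]eq_fun do rewrite mul1r.
  by have := h (-1); under eq_fun do rewrite mulN1r; under [in RHS]eq_fun do rewrite mulN1r.
apply: eq_integral => t _; apply/eqP; rewrite eq_le.
have aux (P : V -> Prop) : (forall x, f x = g x -> P x) -> lout [set x | D x /\ ~ P x] = 0%E.
  move=> hP; apply/eqP; rewrite eq_le lout_ge0 andbT -fg.
  by apply: le_lout => x [Dx nP]; split => // /hP.
by apply/andP; split; apply: lout_ae_le; apply: aux => x ->.
Qed.

Lemma lout_translate_le (A : set V) (z : V) : (lout [set x : V | A (x - z)%R] <= lout A)%E.
Proof.
apply: le_ereal_inf_tmp => _ [a [b [Aab ->]]]; apply: ereal_inf_lbound.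
exists (fun k => a k + z), (fun k => b k + z); split.
  move=> x /= /Aab[k _ xk]; exists k => // i.
  by have := xk i; rewrite !mxE; lra.
apply: eq_eseriesr => k _; congr EFin; apply: eq_bigr => i _.
by rewrite !mxE; congr Num.max; ring.
Qed.

Lemma lout_translate (A : set V) (z : V) : lout [set x | A (x - z)] = lout A.
Proof.
apply/eqP; rewrite eq_le lout_translate_le/=.
have := lout_translate_le [set x | A (x - z)] (- z).
by congr (lout _ <= _)%E; apply/seteqP; split => x /=; rewrite opprK addrK.
Qed.

Lemma lint_translate f (z : V) : lint setT (fun x => f (x - z)) = lint setT f.
Proof.
have h (u : V -> R) : lint_nn setT (fun x => u (x - z)) = lint_nn setT u.
  by apply: eq_integral => t _; rewrite -[RHS](lout_translate _ z).
by rewrite /lint -(h (fun x => Num.max (f x) 0)) -(h (fun x => Num.max (- f x) 0)).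
Qed.

Lemma lout_box_fin (a b : V) : (lout (box a b) < +oo)%E.
Proof. by apply: le_lt_trans (lout_le_vol _ _) _; rewrite ltry. Qed.

End integral_interface.

(** * Functions with continuous weak gradient *)

Section key_estimate.
Variables (R : realType) (n : nat).
Local Notation d := n.+1.
Local Notation V := 'rV[R]_d.

Lemma derive_shift (g : V -> R) (z v x : V) :
  'D_v (fun y => g (z + y)) x = 'D_v g (z + x).
Proof.
rewrite /derive (_ : (fun h : R => _) = (fun h : R =>
  h^-1 *: ((g \o shift (z + x)) (h *: v) - g (z + x))))//.
by apply/funext => h /=; rewrite addrCA.
Qed.

Lemma continuous_compact_le (K : set V) (g : V -> R) : compact K ->
  (forall x, {for x, continuous g}) -> exists2 M, 0 <= M & forall x, K x -> `|g x| <= M.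
Proof.
move=> cK gc.
have cgK : compact (g @` K).
  apply: continuous_compact => //; apply: continuous_subspaceT => x; exact: gc.
have [M0 [_ HM]] := compact_bounded cgK.
have h x : K x -> `|g x| <= `|M0| + 1.
  move=> Kx; apply: (HM (`|M0| + 1)); last by exists x.
  by apply: le_lt_trans (ler_norm M0) _; rewrite ltrDl.
by exists (`|M0| + 1).
Qed.

Lemma lt_box_out (K : set V) (g : V -> R) i x : closed K ->
  (forall y, ~ K y -> g y = 0) -> ~ K x -> partial i g x = 0.
Proof.
move=> cK g0 nKx; rewrite /partial.
rewrite (@near_eq_derive _ _ _ g (fun=> 0) x (evec R i)); first exact: derive_cst.
have : \forall y \near x, ~ K y.
  by apply: open_nbhs_nbhs; split => //; exact: closed_openC.
by apply: filterS => y; exact: g0.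
Qed.

Variables (Om : set V) (oOm : open Om) (f g : V -> R) (i : 'I_d).
Hypothesis weak : forall phi, test_fun Om phi ->
  lint Om (fun x => f x * partial i phi x) = - lint Om (fun x => g x * phi x).

Local Notation e := (evec R i).

Variables A B : V.
Local Notation K := (box A B).
Hypotheses (KOm : K `<=` Om) (If : Ig K f) (Igg : Ig K g).
Variables c eps : R.
Hypothesis gc : forall y, K y -> `|g y - c| <= eps.

Lemma mf_smooth (phi : V -> R) (D : set V) : lmeas D -> Cn 0 setT phi -> mf D phi.
Proof.
move=> mD [pc _]; apply: (@mfS _ _ setT) => //; first exact/lmeas_open/openT.
by apply: mf_continuous; first exact: openT.
Qed.

Lemma mK : lmeas K. Proof. exact: lmeas_box. Qed.

Section one_test_function.
Variables (psi : V -> R) (t : R).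
Local Notation sh s := (fun y : V => psi (s *: e + y)).
Hypotheses (t0 : 0 < t) (psi_ge0 : forall x, 0 <= psi x) (psi_le1 : forall x, psi x <= 1).
Hypothesis Cn_sh : forall s m, Cn m setT (sh s).
Hypothesis sh_test : forall s, 0 <= s <= t -> test_fun Om (sh (- s)).
Hypothesis sh_out : forall s y, 0 <= s <= t -> ~ K y -> psi (- s *: e + y) = 0.

Lemma sh_le1 s y : `|psi (s *: e + y)| <= 1.
Proof. by rewrite ger0_norm. Qed.

Lemma mf_sh s : mf K (sh s).
Proof. by apply: mf_smooth; [exact: mK|exact: Cn_sh]. Qed.

Lemma Ig_sh s : Ig K (sh s).
Proof.
apply: (@Ig_bounded _ _ _ _ 1); [exact: mK|exact: lout_box_fin|exact: mf_sh|].
by move=> x _; exact: sh_le1.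
Qed.

(** All these translates vanish outside [K], so the integrals are over the whole space, where
    translation invariance holds. *)
Lemma Int_sh s : 0 <= s <= t -> Int K (sh (- s)) = Int K psi.
Proof.
have h s' : 0 <= s' <= t -> Int K (sh (- s')) = lint setT (sh (- s')).
  move=> st; rewrite (@lint_restrict _ _ setT K)//; last first.
    by move=> x _; exact: sh_out.
  rewrite lint_Int//; [exact: mK|exact: Ig_sh].
move=> st; rewrite (h s st).
have -> : Int K psi = Int K (sh (- 0)).
  by apply: Int_eq => x _; rewrite oppr0 scale0r add0r.
have st0 : 0 <= (0 : R) <= t by rewrite lexx (ltW t0).
rewrite (h 0 st0) oppr0.
rewrite -[RHS](lint_translate _ (s *: e)); congr lint; apply/funext => x.
by rewrite scale0r add0r scaleNr addrC.
Qed.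

(** The translate of [psi] is itself a test function, whose partial derivative is the translate of
    that of [psi]. As it vanishes outside [K], both integrals over [Om] reduce to [K]. *)
Lemma IntM_deriv s : 0 <= s <= t ->
  Int K (fun y => f y * partial i psi (- s *: e + y)) = - Int K (fun y => g y * psi (- s *: e + y)).
Proof.
move=> st.
have pE y : partial i (sh (- s)) y = partial i psi (- s *: e + y) by exact: derive_shift.
have H : lint Om (fun y => f y * partial i psi (- s *: e + y)) =
    - lint Om (fun y => g y * psi (- s *: e + y)).
  have <- := weak (sh_test st); congr (lint Om _).
  by apply/funext => y; rewrite -pE.
have out1 y : Om y -> ~ K y -> f y * partial i psi (- s *: e + y) = 0.
  move=> _ nK; rewrite -pE (lt_box_out (K := K) _ _ _ nK) ?mulr0//.
    exact: closed_box.
  by move=> z; exact: sh_out.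
have out2 y : Om y -> ~ K y -> g y * psi (- s *: e + y) = 0.
  by move=> _ nK; rewrite sh_out// mulr0.
have pc x : {for x, continuous (partial i (sh (- s)))}.
  by apply: (Cn_cont (Cn_partial i (Cn_sh (- s) 1))).
have [M M0 HM] := continuous_compact_le (@compact_box R d A B) pc.
have I1 : Ig K (fun y => f y * partial i psi (- s *: e + y)).
  apply: (@Ig_bdd_mul _ _ _ _ _ M); [exact: mK|exact: If| |].
    apply: (@mf_smooth (fun y => partial i psi (- s *: e + y))); first exact: mK.
    rewrite -(_ : partial i (sh (- s)) = (fun y => partial i psi (- s *: e + y))).
      exact: Cn_partial (Cn_sh (- s) 1).
    by apply/funext => y; exact: pE.
  by move=> x /HM; rewrite pE.
have I2 : Ig K (fun y => g y * psi (- s *: e + y)).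
  apply: (@Ig_bdd_mul _ _ _ _ _ 1); [exact: mK|exact: Igg|exact: mf_sh|].
  by move=> x _; exact: sh_le1.
by rewrite -(lint_Int mK I1) -(lint_Int mK I2) -(lint_restrict KOm out1) -(lint_restrict KOm out2).
Qed.

Lemma Int_g_bound s : 0 <= s <= t ->
  `|Int K (fun y => g y * psi (- s *: e + y)) - c * Int K psi| <= eps * Int K psi.
Proof.
move=> st; rewrite -(Int_sh st) -!IntZ; [|exact: mK|exact: Ig_sh|exact: mK|exact: Ig_sh].
have IG : Ig K (fun y => g y * psi (- s *: e + y)).
  apply: (@Ig_bdd_mul _ _ _ _ _ 1) => //; [exact: mK|exact: mf_sh|].
  by move=> x _; exact: sh_le1.
have IC r : Ig K (fun y => r * psi (- s *: e + y)).
  by apply: IgZ; [exact: mK|exact: Ig_sh].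
rewrite -IntB//; last exact: mK.
apply: Int_abs_le => //; [exact: mK| |].
  by apply: IgB => //; exact: mK.
move=> x Kx; rewrite -mulrBl normrM (ger0_norm (psi_ge0 _)).
by rewrite ler_wpM2r// gc.
Qed.

(** Let Phi(s) be the integral of f times psi(s e + y). Differentiation under the integral sign and
    [IntM_deriv] give Phi'(s) as minus the integral of g psi(s e + y), which is within eps of -c
    times the integral of psi, relative to the latter. The mean value theorem on [-t, 0]
    concludes. *)
Lemma test_increment :
  `|Int K (fun y => f y * psi (- t *: e + y)) - Int K (fun y => f y * psi y)
    - t * c * Int K psi| <= t * eps * Int K psi.
Proof.
pose F (s : R) (y : caratheodory_type (@lout R d)) : R := f y * psi (s *: e + y).
pose Phi (s : R) : R := Rintegral (@lebd R n) (K : set (caratheodory_type (@lout R d))) (F s).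
have psiC1 : Cn 1 setT psi.
  have := Cn_sh 0 1; congr Cn; apply/funext => y.
  by rewrite scale0r add0r.
have dF (s : R) (y : V) : is_derive s 1 (fun s => F s y) (f y * partial i psi (s *: e + y)).
  have H : is_derive (s *: e + y) e psi (partial i psi (s *: e + y)).
    by apply: Cn_is_derive psiC1 _.
  have := is_deriveM (is_derive_cst (f y) s 1) (line_is_derive H).
  by rewrite scaler0 addr0.
have pc x : {for x, continuous (partial i psi)}.
  exact: (Cn_cont (Cn_partial i psiC1)).
(* The parameter runs over the open interval from -t - 1 to 1, so that Phi has two-sided derivatives
   at both ends of [-t, 0]. Points of [K] then move by at most t + 1, whence the enlarged box. *)
have [M M0 HM] := continuous_compact_le
  (@compact_box R d (A - const_mx (t + 1)) (B + const_mx (t + 1))) pc.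
have hM (s : R) (y : V) : `](- t - 1), 1[%classic s -> K y -> `|partial i psi (s *: e + y)| <= M.
  rewrite /= in_itv/= => /andP[s1 s2] Ky; apply: HM => j.
  have := Ky j; rewrite !mxE; move: t0 s1 s2.
  by rewrite eqxx; case: (j == i) => /=; rewrite ?mulr1 ?mulr0; lra.
have If' : (@lebd R n).-integrable (K : set (caratheodory_type (@lout R d)))
    (EFin \o (fun y => M * `|f y|)).
  apply: IgZ; first exact: mK.
  exact: (integrable_abse If).
have IF (s : R) : Ig K (F s).
  apply: (@Ig_bdd_mul _ _ _ _ _ 1) => //; [exact: mK|exact: mf_sh|].
  by move=> x _; exact: sh_le1.
have p1E (s : R) (y : V) : partial1of2 F s y = f y * partial i psi (s *: e + y).
  by rewrite partial1of2E; have [_ ->] := dF s y.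
have dPhi (s : R) : - t <= s <= 0 ->
    is_derive s 1 Phi (Int K (fun y => f y * partial i psi (s *: e + y))).
  move=> st; have sI : `](- t - 1), 1[%classic s by rewrite /= in_itv/=; move: st; lra.
  have HG (y : caratheodory_type (@lout R d)) : 0 <= M * `|f y| by rewrite mulr_ge0.
  have HB s' (y : caratheodory_type (@lout R d)) : `](- t - 1), 1[%classic s' -> K y ->
      `|partial1of2 F s' y| <= M * `|f y|.
    by move=> s'I Ky; rewrite p1E normrM mulrC ler_wpM2r// hM.
  have HD s' (y : caratheodory_type (@lout R d)) : `](- t - 1), 1[%classic s' -> K y ->
      derivable (F ^~ y) s' 1 by move=> _ _; case: (dF s' y).
  have HI s' : `](- t - 1), 1[%classic s' -> (@lebd R n).-integrable
      (K : set (caratheodory_type (@lout R d))) (EFin \o F s') by move=> _; exact: IF.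
  have mKU : measurable (K : set (caratheodory_type (@lout R d))) by exact: mK.
  apply: DeriveDef.
    exact: (derivable_under_integral mKU sI HI HD HG If' HB).
  rewrite -derive1E (differentiation_under_integral mKU sI HI HD HG If' HB).
  by apply: eq_Rintegral => y _; rewrite p1E.
have tt : - t < 0 by rewrite oppr_lt0.
have [||s sI E] := @MVT R Phi (fun s => Int K (fun y => f y * partial i psi (s *: e + y)))
    _ _ tt.
- by move=> s; rewrite in_itv/= => /andP[/ltW s1 /ltW s2]; apply: dPhi; rewrite s1 s2.
- apply: derivable_within_continuous => s; rewrite in_itv/= => st.
  by case: (dPhi s st).
move: sI; rewrite in_itv/= => /andP[s1 s2].
have st : 0 <= - s <= t by move: s1 s2; lra.
have := IntM_deriv st; rewrite opprK => E2.
have := Int_g_bound st; rewrite opprK => E3.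
have PhiE r : Phi r = Int K (fun y => f y * psi (r *: e + y)) by [].
have Phi0 : Phi 0 = Int K (fun y => f y * psi y).
  by rewrite PhiE; apply: Int_eq => y _; rewrite scale0r add0r.
rewrite -PhiE -Phi0.
set X := Int K (fun y => g y * psi (s *: e + y)) in E2 E3.
have -> : Phi (- t) - Phi 0 - t * c * Int K psi = t * (X - c * Int K psi).
  have -> : Phi (- t) - Phi 0 = - (Phi 0 - Phi (- t)) by rewrite opprB.
  by rewrite E E2; ring.
by rewrite normrM (gtr0_norm t0) -mulrA ler_wpM2l// ltW.
Qed.

End one_test_function.

Definition box_int (a b : V) (h : V -> R) : R := Int (hbox a b) h.

Lemma ebump_cvg1 (r : nat -> R) (dl : R) : 0 < dl ->
  (forall k, k.+1%:R * dl <= r k) -> (fun k => ebump 0 (r k)) @ \oo --> (1 : R).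
Proof.
move=> dl0 hr.
apply: (@squeeze_cvgr _ _ _ _ (fun k => 1 - dl^-1 * k.+1%:R^-1) (fun=> 1)).
- apply: nearW => k; rewrite ebump0_le1 andbT.
  have rk : 0 < r k by apply: lt_le_trans (hr k); rewrite mulr_gt0.
  rewrite /ebump rk mul1r; apply: le_trans (expR_ge1Dx _).
  rewrite lerD2l lerN2 -invfM mulrC lef_pV2 ?posrE// mulr_gt0//.
- rewrite -[X in _ --> X]subr0 -[X in _ - X](mulr0 dl^-1).
  apply: cvgB; first exact: cvg_cst.
  by apply: cvgM; [exact: cvg_cst|exact: cvg_harmonic].
- exact: cvg_cst.
Qed.

(** On the upper face x_j = b_j the second factor is evaluated at (k+1)^2 / (k+1) = k + 1, which
    tends to infinity, so that face belongs to the limit. On the lower face the first factor is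
    always 0. This is why the limit is the half-open box. *)
Lemma tbump_cvg (a b x : V) :
  (fun k => tbump k.+1%:R (k.+1%:R ^+ 2) a (b + const_mx k.+1%:R^-1) x) @ \oo -->
  (if x \in hbox a b then 1 else 0 : R).
Proof.
case: ifPn => [/set_mem xab|/negP xab].
  pose F k (j : 'I_d) := ebump 0 (k.+1%:R * x 0 j - k.+1%:R * a 0 j) *
    ebump 0 (- k.+1%:R ^+ 2 * x 0 j + k.+1%:R ^+ 2 * (b + const_mx k.+1%:R^-1) 0 j).
  have FC (j : 'I_d) : (fun k => F k j) @ \oo --> (1 : R).
    have /andP[ax xb] := xab j.
    rewrite -[X in _ --> X](mulr1 (1 : R)); apply: cvgM.
      apply: (@ebump_cvg1 _ (x 0 j - a 0 j)); first by rewrite subr_gt0.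
      by move=> k; rewrite mulrBr.
    apply: (@ebump_cvg1 _ 1) => // k.
    rewrite !mxE mulr1 mulrDr expr2 -(mulrA _ _ k.+1%:R^-1) mulfV// mulr1 addrA.
    by rewrite lerDr mulNr addrC -mulrBr mulr_ge0 ?subr_ge0// mulr_ge0.
  have FP (r : seq 'I_d) : (fun k => \prod_(j <- r) F k j) @ \oo --> (1 : R).
    elim: r => [|j r IH]; first by under eq_fun do rewrite big_nil; exact: cvg_cst.
    under eq_fun do rewrite big_cons.
    by have H := cvgM (FC j) IH; rewrite mulr1 in H; exact: H.
  exact: FP.
have [j xj] : exists j, ~~ (a 0 j < x 0 j <= b 0 j).
  apply: contrapT => /forallNP h; apply: xab; apply: mem_set => j.
  by have /negP := h j; rewrite negbK.
apply: cvg_near_cst.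
have zero k : ~~ (a 0 j < x 0 j < (b + const_mx k.+1%:R^-1) 0 j) ->
    tbump k.+1%:R (k.+1%:R ^+ 2) a (b + const_mx k.+1%:R^-1) x = 0.
  move=> h; apply/eqP; apply: contrapT => /negP h2; move/negP: h; apply.
  exact: (tbump_neq0 (ltr0Sn R k) (exprn_gt0 2 (ltr0Sn R k)) h2 j).
have [xa|ax] := leP (x 0 j) (a 0 j).
  by apply: nearW => k; apply: zero; rewrite ltNge xa.
move: xj; rewrite ax/= -ltNge => bx.
have : \forall k \near \oo, (k.+1%:R^-1 : R) < x 0 j - b 0 j.
  by apply: (cvgr_lt (0 : R) (@cvg_harmonic R)); rewrite subr_gt0.
apply: filterS => k hk; apply: zero.
by rewrite ax/= -leNgt !mxE -lerBrDl ltW.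
Qed.

(** [test_increment] for bumps that tend to the indicator of the box, in the limit by dominated
    convergence. The room [dl] keeps the supports, which exceed the box by 1/(k+1), inside [K] for
    large k. *)
Lemma box_int_increment (a b : V) (t dl : R) : 0 < t -> 0 < dl ->
  (forall j, A 0 j <= a 0 j) -> (forall j, a 0 j <= b 0 j) ->
  (forall j, b 0 j + t * (j == i)%:R + dl <= B 0 j) ->
  `|box_int (a + t *: e) (b + t *: e) f - box_int a b f - t * c * vol a b| <= t * eps * vol a b.
Proof.
move=> t0 dl0 Aa ab bB.
pose b_ k : V := b + const_mx k.+1%:R^-1.
pose psi k : V -> R := tbump k.+1%:R (k.+1%:R ^+ 2) a (b_ k).
have e1 s j : (s *: e) 0 j = s * (j == i)%:R by rewrite !mxE eqxx.
have psi0 k x : 0 <= psi k x by exact: tbump_ge0.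
have psi1 k x : psi k x <= 1 by exact: tbump_le1.
have psin k x : `|psi k x| <= 1 by rewrite ger0_norm.
have psit k s y : psi k (- s *: e + y) =
    tbump k.+1%:R (k.+1%:R ^+ 2) (a + s *: e) (b_ k + s *: e) y.
  by rewrite tbump_translate scaleNr addrC.
have psiC k s m : Cn m setT (fun y => psi k (s *: e + y)).
  have := Cn_tbump k.+1%:R (k.+1%:R ^+ 2) (a + - s *: e) (b_ k + - s *: e) m.
  by congr Cn; apply/funext => y; rewrite -psit opprK.
have inc : \forall k \near \oo,
   `|Int K (fun y => f y * psi k (- t *: e + y)) - Int K (fun y => f y * psi k y)
    - t * c * Int K (psi k)| <= t * eps * Int K (psi k).
  have : \forall k \near \oo, (k.+1%:R^-1 : R) < dl.
    by apply: (cvgr_lt (0 : R) (@cvg_harmonic R)).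
  apply: filterS => k hk.
  have inK s : 0 <= s <= t -> box (a + s *: e) (b_ k + s *: e) `<=` K.
    move=> /andP[s0 st] x xs j; have := xs j; rewrite !mxE eqxx/=.
    have := Aa j; have := bB j; move: hk s0 st; move: (k.+1%:R^-1) => u.
    by case: (j == i) => /=; rewrite ?mulr1 ?mulr0; lra.
  apply: test_increment; [exact: t0|exact: psi0|exact: psi1|exact: psiC| |].
  - move=> s st; rewrite (_ : (fun y => _) =
      tbump k.+1%:R (k.+1%:R ^+ 2) (a + s *: e) (b_ k + s *: e)); last first.
      by apply/funext => y; exact: psit.
    apply: test_fun_tbump; rewrite ?exprn_gt0//.
    exact: subset_trans (inK s st) KOm.
  - move=> s y st nK; rewrite psit; apply/eqP; apply: contrapT => /negP h.
    apply: nK; apply: (inK s st) => j.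
    have /andP[h1 h2] := tbump_neq0 (ltr0Sn R k) (exprn_gt0 2 (ltr0Sn R k)) h j.
    by rewrite (ltW h1) (ltW h2).
have HK s : 0 <= s <= t -> hbox (a + s *: e) (b + s *: e) `<=` K.
  move=> /andP[s0 st] x xs j; have := xs j; rewrite !mxE eqxx/=.
  have := Aa j; have := bB j; move: dl0 s0 st.
  by case: (j == i) => /=; rewrite ?mulr1 ?mulr0; lra.
have pw s y : (fun k => psi k (- s *: e + y)) @ \oo -->
    (if y \in hbox (a + s *: e) (b + s *: e) then 1 else 0 : R).
  under eq_fun do rewrite psit /b_ addrAC.
  exact: tbump_cvg.
have Ihb (h : V -> R) s : 0 <= s <= t -> Ig K h ->
    Ig K (fun y => if y \in hbox (a + s *: e) (b + s *: e) then h y else 0).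
  move=> st Ih; set H := hbox _ _.
  have mi : mf K (fun y => \1_H y : R) by apply: measurable_indic; exact: lmeas_hbox.
  apply: (Ig_eq mK (f := fun y => h y * \1_H y)).
    by move=> y _; rewrite indicE; case: (_ \in _); rewrite ?mulr1 ?mulr0.
  apply: (@Ig_bdd_mul _ _ _ _ _ 1); [exact: mK|exact: Ih|exact: mi|].
  by move=> y _; rewrite indicE; case: (_ \in _); rewrite ?normr1 ?normr0.
have lim1 (h : V -> R) s : 0 <= s <= t -> Ig K h ->
   (fun k => Int K (fun y => h y * psi k (- s *: e + y))) @ \oo -->
     box_int (a + s *: e) (b + s *: e) h.
  move=> st Ih; rewrite /box_int -(Int_restrict _ (HK s st)).
  apply: (@Int_dct _ _ _ _ h) => //; [exact: mK|exact: Ihb| | |].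
  - move=> k; apply: mfM; first exact: Ig_mf.
    by apply: mf_smooth; [exact: mK|exact: psiC].
  - by move=> k x _; rewrite normrM ler_piMr.
  - move=> x _; rewrite (_ : (if _ then _ else _) =
      h x * (if x \in hbox (a + s *: e) (b + s *: e) then 1 else 0)).
      by apply: cvgM; [exact: cvg_cst|exact: pw].
    by case: ifP => _; rewrite ?mulr1 ?mulr0.
have z0t : 0 <= (0 : R) <= t by rewrite lexx ltW.
have ztt : 0 <= t <= t by rewrite lexx ltW.
have sh0 (z : V) : z + 0 *: e = z by rewrite scale0r addr0.
have L1 := lim1 f t ztt If.
have L0 : (fun k => Int K (fun y => f y * psi k y)) @ \oo --> box_int a b f.
  have E : (fun k => Int K (fun y => f y * psi k (- 0 *: e + y))) =
      (fun k => Int K (fun y => f y * psi k y)).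
    by apply/funext => k; apply: Int_eq => y _; rewrite oppr0 scale0r add0r.
  by have H := lim1 f 0 z0t If; rewrite E !sh0 in H; exact: H.
have I1 : Ig K (fun=> 1) by apply: Ig_cst; [exact: mK|exact: lout_box_fin].
(* The same limit, applied to the constant 1 instead of f. *)
have LV : (fun k => Int K (psi k)) @ \oo --> vol a b.
  have E : (fun k => Int K (fun y => 1 * psi k (- 0 *: e + y))) = (fun k => Int K (psi k)).
    by apply/funext => k; apply: Int_eq => y _; rewrite oppr0 scale0r add0r mul1r.
  have E1 : box_int a b (fun=> 1) = vol a b.
    by rewrite /box_int (Int_cst _ (@lmeas_hbox _ _ a b)) lout_hbox// mul1r.
  by have H := lim1 (fun=> 1) 0 z0t I1; rewrite E !sh0 E1 in H; exact: H.
apply: (ler_cvg_to _ _ inc).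
- apply: cvg_norm; apply: cvgB; first exact: cvgB.
  by apply: cvgM => //; exact: cvg_cst.
- by apply: cvgM => //; exact: cvg_cst.
Qed.

End key_estimate.

(** * Functions whose integrals over all boxes vanish *)

Section vanishing.
Variables (R : realType) (n : nat).
Local Notation d := n.+1.
Local Notation V := 'rV[R]_d.
Local Notation U := (caratheodory_type (@lout R d)).
Local Notation mu := (@lebd R n).
Implicit Types (D K E : set V) (u f : V -> R).

Lemma Ig_ind D K f : lmeas D -> lmeas K -> Ig D f ->
  Ig D (fun y => if y \in K then f y else 0).
Proof.
move=> mD mK If.
have mi : mf D (fun y => \1_K y : R) by apply: measurable_indic; exact: mK.
apply: (Ig_eq mD (f := fun y => f y * \1_K y)).
  by move=> y _; rewrite indicE; case: (_ \in _); rewrite ?mulr1 ?mulr0.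
apply: (@Ig_bdd_mul _ _ _ _ _ 1); [exact: mD|exact: If|exact: mi|].
by move=> y _; rewrite indicE; case: (_ \in _); rewrite ?normr1 ?normr0.
Qed.

Lemma Int_null N f : lmeas N -> mf N f -> lout N = 0%E -> Int N f = 0.
Proof.
move=> mN mf_ N0; rewrite /Int /Rintegral.
have mf2 : measurable_fun (N : set U) (fun x => (f x)%:E) by apply/measurable_EFinP.
by rewrite (null_set_integral (mu := mu) (mN : measurable (N : set U)) mf2 N0).
Qed.

Lemma Int_diff D K f : lmeas D -> lmeas K -> K `<=` D -> Ig D f ->
  Int D f = Int K f + Int (D `&` ~` K) f.
Proof.
move=> mD mK KD If.
have E : D = K `|` (D `&` ~` K).
  apply/seteqP; split => [x Dx|x [/KD//|[]//]].
  by have [Kx|nKx] := pselect (K x); [left|right].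
rewrite {1}E Int_setU -?E//; first by apply: lmeasI => //; exact: lmeasC.
by apply/seteqP; split => // x [Kx [_]].
Qed.

Lemma lout_diff D K : lmeas K -> K `<=` D -> (lout K < +oo)%E ->
  (lout D <= lout K)%E -> lout (D `&` ~` K) = 0%E.
Proof.
move=> mK KD fK DK; have := mK D; rewrite (setIidr KD) => E.
have kf : lout K \is a fin_num by rewrite ge0_fin_numE ?lout_ge0.
apply/eqP; rewrite eq_le lout_ge0 andbT.
by move: DK; rewrite E -leeBrDl// subee.
Qed.

Section dynkin.
Variables (lo hi : V) (u : V -> R).
Let D := box lo hi.
Hypothesis Iu : Ig D u.
Hypothesis J0 : forall a b : V, (forall j, lo 0 j <= a 0 j) -> (forall j, a 0 j <= b 0 j) ->
  (forall j, b 0 j <= hi 0 j) -> box_int a b u = 0.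

Let mD : lmeas D. Proof. exact: lmeas_box. Qed.

Let vanish : set (set V) := [set E | lmeas E /\ Int (E `&` D) u = 0].

Let boxes : set (set V) := [set E | exists a b, E = box a b].

Lemma boxI (a b a' b' : V) : box a b `&` box a' b' =
  box (\row_j Num.max (a 0 j) (a' 0 j)) (\row_j Num.min (b 0 j) (b' 0 j)).
Proof.
apply/seteqP; split => [x [h1 h2] j|x h]; first by
  have := h1 j; have := h2 j; rewrite !mxE ge_max le_min => /andP[-> ->] /andP[-> ->].
by split => j; have := h j; rewrite !mxE ge_max le_min => /andP[/andP[? ?] /andP[? ?]]; apply/andP.
Qed.

(** The hypothesis concerns half-open boxes, but closed boxes are needed: they are stable under
    intersection and are the ones that occur in covers. The two kinds differ by a null set, since
    both have outer measure [vol a b]. *)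
Lemma Int_box0 (a b : V) : box a b `<=` D -> Int (box a b) u = 0.
Proof.
move=> abD; have [/forallP ab|/forallPn[j]] := boolP [forall j, a 0 j <= b 0 j]; last first.
  rewrite -ltNge => ba; have -> : box a b = set0.
    apply/seteqP; split => // x /(_ j) /andP[h1 h2].
    by have := le_trans h1 h2; rewrite leNgt ba.
  by rewrite /Int Rintegral_set0.
have Iab : Ig (box a b) u by apply: IgS Iu; [exact: mD|exact: lmeas_box|].
have aD : D a by apply: abD => j; rewrite lexx ab.
have bD : D b by apply: abD => j; rewrite lexx ab.
have mh := @lmeas_hbox _ _ a b; have mb := @lmeas_box _ _ a b.
rewrite (Int_diff mb mh (@hbox_sub_box _ _ a b) Iab).
have -> : Int (hbox a b) u = 0.
  by apply: J0 => // j; [have /andP[] := aD j|have /andP[] := bD j].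
rewrite add0r; apply: Int_null.
- by apply: lmeasI => //; exact: lmeasC.
- by apply: (mfS mb) (Ig_mf Iab) => x [].
- apply: lout_diff => //; first exact: hbox_sub_box.
    by rewrite lout_hbox// ltry.
  by rewrite lout_hbox//; exact: lout_le_vol.
Qed.

Lemma vanish_lambda : lambda_system setT vanish.
Proof.
have IE E : lmeas E -> Ig (E `&` D) u.
  by move=> mE; apply: IgS Iu; [exact: mD|exact: lmeasI|move=> x []].
split => //.
- split; first by rewrite lmeasE; exact: measurableT.
  by rewrite setTI; apply: Int_box0.
- move=> A B BA [mA A0] [mB B0]; split; first by apply: lmeasI => //; exact: lmeasC.
  have := @Int_diff (A `&` D) (B `&` D) u (lmeasI mA mD) (lmeasI mB mD) _ (IE A mA).
  rewrite A0 B0 add0r => E; rewrite [RHS]E; last by move=> x [/BA ? ?].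
  congr Int; apply/seteqP; split => x; first by move=> [[Ax nBx] Dx]; split => // -[].
  by move=> [[Ax Dx] nBD]; split => //; split => // Bx; exact: nBD.
- move=> F ndF F0.
  have mF : lmeas (\bigcup_k F k).
    rewrite lmeasE; apply: (@bigcup_measurable _ U) => k _; exact: (F0 k).1.
  split => //.
  have L : (fun k => Int D (fun y => if y \in F k `&` D then u y else 0)) @ \oo -->
      Int D (fun y => if y \in (\bigcup_k F k) `&` D then u y else 0).
    apply: (@Int_dct _ _ _ _ u) => //.
    - by apply: Ig_ind => //; exact: lmeasI.
    - by move=> k; apply: Ig_mf; apply: Ig_ind => //; apply: lmeasI => //; exact: (F0 k).1.
    - by move=> k x _; case: ifP => // _; rewrite normr0.
    - move=> x Dx; apply: cvg_near_cst.
      have [[k _ Fx]|nx] := pselect ((\bigcup_k F k) x).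
        exists k => // m km; rewrite !mem_set//; split => //; first by exists k.
        by move/subsetPset: (ndF _ _ km) => /(_ _ Fx).
      apply: nearW => k; rewrite !memNset// => -[Fx _]; apply: nx => //; by exists k.
  rewrite Int_restrict in L; last by move=> x [].
  have Z : (fun k => Int D (fun y => if y \in F k `&` D then u y else 0)) = fun=> 0.
    by apply/funext => k; rewrite Int_restrict; [exact: (F0 k).2|move=> x []].
  by rewrite Z in L; rewrite -(cvg_lim _ L)// lim_cst.
Qed.

Lemma sigma_vanish E : <<s boxes >> E -> lmeas E /\ Int (E `&` D) u = 0.
Proof.
apply: (lambda_system_subset _ vanish_lambda); last by [].
- by move=> _ _ [a [b ->]] [a' [b' ->]]; rewrite boxI; do 2 eexists.
- move=> _ [a [b ->]]; split; first exact: lmeas_box.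
  by rewrite boxI; apply: Int_box0; rewrite -boxI => x [].
Qed.

(** Outer approximation: E = {u > t} lies in an intersection B of countable unions of boxes, with B
    minus E null. The integral of u over B within D is 0 by the Dynkin argument, hence so is that
    over E, which is at least t times the measure of E. *)
Lemma lout_super0 (t : R) : 0 < t -> lout [set x | D x /\ t < u x] = 0%E.
Proof.
move=> t0; set E := [set x | _].
have mE : lmeas E by apply: ((lmeasfunP u mD).2 (Ig_mf Iu)).
have ED : E `<=` D by move=> x [].
have fE : (lout E < +oo)%E by apply: le_lt_trans (le_lout ED) (lout_box_fin _ _).
have ffE : lout E \is a fin_num by rewrite ge0_fin_numE ?lout_ge0.
have cover (N : nat) : exists ab : (nat -> V) * (nat -> V),
    E `<=` \bigcup_k box (ab.1 k) (ab.2 k) /\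
    (lout (\bigcup_k box (ab.1 k) (ab.2 k)) <= lout E + (N.+1%:R^-1)%:E)%E.
  have N0 : 0 < N.+1%:R^-1 :> R by rewrite invr_gt0.
  have [a [b [Eab ab]]] := lout_adherent N0 ffE.
  exists (a, b); split => //; apply: le_trans ab.
  apply: le_trans (lout_sigma_subadditive _) _.
  by apply: lee_nneseries => [k _ _|k _]; [exact: lout_ge0|exact: lout_le_vol].
have [c cP] := choice cover.
pose C N := \bigcup_k box ((c N).1 k) ((c N).2 k).
pose B := \bigcap_N C N.
have EB : E `<=` B by move=> x Ex N _; exact: (cP N).1.
have sB : <<s boxes >> B.
  have [s0 sC sU] := smallest_sigma_algebra setT boxes.
  rewrite -[B]setCK setC_bigcap -setTD; apply: (sC); apply: (sU) => N.
  rewrite -setTD; apply: (sC); apply: (sU) => k; apply: sub_sigma_algebra.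
  by do 2 eexists.
have [mB B0] := sigma_vanish sB.
have BE : lout (B `&` ~` E) = 0%E.
  apply: lout_diff => //; apply/lee_addgt0Pr => e e0.
  have [N _ hN] := near_infty_natSinv_lt (PosNum e0).
  apply: (@le_trans _ _ (lout (C N))); first by apply: le_lout => x; exact.
  apply: le_trans (cP N).2 _; rewrite leeD2l// lee_fin ltW//; exact: (hN N (leqnn _)).
have mBD := lmeasI mB mD.
have IBD : Ig (B `&` D) u by apply: IgS Iu => // x [].
have EBD : E `<=` B `&` D by move=> x Ex; split; [exact: EB|exact: ED].
have := Int_diff mBD mE EBD IBD; rewrite B0.
have -> : Int ((B `&` D) `&` ~` E) u = 0.
  have mN : lmeas ((B `&` D) `&` ~` E) by apply: lmeasI => //; exact: lmeasC.
  apply: Int_null => //; first by apply: (mfS mBD) (Ig_mf IBD) => x [].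
  apply/eqP; rewrite eq_le lout_ge0 andbT -BE.
  by apply: le_lout => x [[Bx _] nEx]; split.
rewrite addr0 => E0.
have IE : Ig E u by apply: IgS Iu.
have := @Int_le _ _ E (fun=> t) u mE (Ig_cst t mE fE) IE (fun x Ex => ltW Ex.2).
rewrite -E0 Int_cst// pmulr_rle0// => h.
have : fine (lout E) = 0 by apply/eqP; rewrite eq_le h/= fine_ge0// lout_ge0.
by move=> h0; rewrite -(fineK ffE) h0.
Qed.

End dynkin.

Lemma ae_zero_of_box_int0 (lo hi : V) u : Ig (box lo hi) u ->
  (forall a b : V, (forall j, lo 0 j <= a 0 j) -> (forall j, a 0 j <= b 0 j) ->
    (forall j, b 0 j <= hi 0 j) -> box_int a b u = 0) ->
  lout [set x | box lo hi x /\ u x <> 0] = 0%E.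
Proof.
move=> Iu J0; have mD := @lmeas_box _ _ lo hi.
have InU : Ig (box lo hi) (fun x => -1 * u x) by exact: IgZ.
have J0' (a b : V) : (forall j, lo 0 j <= a 0 j) -> (forall j, a 0 j <= b 0 j) ->
    (forall j, b 0 j <= hi 0 j) -> box_int a b (fun x => -1 * u x) = 0.
  move=> la ab bh; rewrite /box_int IntZ.
  - by have := J0 a b la ab bh; rewrite /box_int => ->; rewrite mulr0.
  - exact: lmeas_hbox.
  - apply: IgS Iu => //; first exact: lmeas_hbox.
    move=> x xab j; have /andP[h1 h2] := xab j.
    by rewrite (le_trans (la j) (ltW h1)) (le_trans h2 (bh j)).
pose P k := [set x | box lo hi x /\ k.+1%:R^-1 < u x].
pose Q k := [set x | box lo hi x /\ k.+1%:R^-1 < -1 * u x].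
have k0 k : 0 < k.+1%:R^-1 :> R by rewrite invr_gt0.
have S0 (F : nat -> set V) : (forall k, lout (F k) = 0%E) -> lout (\bigcup_k F k) = 0%E.
  move=> F0; apply/eqP; rewrite eq_le lout_ge0 andbT.
  by apply: le_trans (lout_sigma_subadditive _) _; rewrite eseries0.
have PQ : [set x | box lo hi x /\ u x <> 0] `<=` \bigcup_k P k `|` \bigcup_k Q k.
  move=> x [Dx /eqP]; rewrite neq_lt => /orP[ux|ux]; [right|left].
    have ux' : 0 < - u x by rewrite oppr_gt0.
    have [N _ hN] := near_infty_natSinv_lt (PosNum ux').
    by exists N => //; split=> //=; rewrite mulN1r; exact: (hN N (leqnn _)).
  have [N _ hN] := near_infty_natSinv_lt (PosNum ux).
  by exists N => //; split=> //=; exact: (hN N (leqnn _)).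
apply/eqP; rewrite eq_le lout_ge0 andbT.
apply: le_trans (le_lout PQ) _; apply: le_trans (@outer_measureU2 _ _ (@lout R d) _ _) _.
have P0 := S0 P (fun k => lout_super0 Iu J0 (k0 k)).
have Q0 := S0 Q (fun k => lout_super0 InU J0' (k0 k)).
have {}P0 : (lout (\bigcup_k P k) <= 0)%E by rewrite P0.
have {}Q0 : (lout (\bigcup_k Q k) <= 0)%E by rewrite Q0.
by apply: le_trans (leeD P0 Q0) _; rewrite adde0.
Qed.

End vanishing.

(** * Subdivision into cubes and coordinate paths *)

Section grid.
Variables (R : realType) (n : nat).
Local Notation d := n.+1.
Local Notation V := 'rV[R]_d.

Lemma hbox_split (a b : V) (i : 'I_d) (c : R) : a 0 i <= c <= b 0 i ->
  hbox a b = hbox a (upd b i c) `|` hbox (upd a i c) b.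
Proof.
move=> /andP[ac cb]; apply/seteqP; split=> x.
  move=> xab; have [xc|cx] := leP (x 0 i) c; [left|right] => j; rewrite updE.
    by case: eqP => [->|_]; [have /andP[-> _] := xab i; rewrite xc|exact: xab].
  by case: eqP => [->|_]; [have /andP[_ ->] := xab i; rewrite cx|exact: xab].
case=> h j; have := h j; rewrite updE; case: eqP => [->|//].
  by move=> /andP[-> xc]; exact: le_trans xc cb.
by move=> /andP[cx ->]; rewrite andbT; exact: le_lt_trans ac cx.
Qed.

Lemma box_int_split (u : V -> R) (a b : V) (i : 'I_d) (c : R) : a 0 i <= c <= b 0 i ->
  Ig (hbox a b) u -> box_int a b u = box_int a (upd b i c) u + box_int (upd a i c) b u.
Proof.
move=> acb Iu; rewrite /box_int (hbox_split acb) Int_setU//; try exact: lmeas_hbox.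
  by rewrite -(hbox_split acb).
apply/seteqP; split => // x [/= h1 h2].
have := h1 i; have := h2 i; rewrite !updE eqxx => /andP[cx _] /andP[_].
by rewrite leNgt cx.
Qed.

Section grid_bound.
Variables (u : V -> R) (lo hi : V) (h Bd : R).
Hypotheses (h0 : 0 < h) (Iu : Ig (box lo hi) u).
Hypothesis cubes : forall a : V, (forall j, lo 0 j <= a 0 j) ->
  (forall j, a 0 j + h <= hi 0 j) -> `|box_int a (a + const_mx h) u| <= Bd * h ^+ d.

(** There are k j + 1 cubes along coordinate j, so that k = 0 is a single cube, the base of the
    induction. *)
Definition gridtop (a : V) (k : 'I_d -> nat) : V := \row_j (a 0 j + (k j).+1%:R * h).

Lemma grid_bound (k : 'I_d -> nat) (a : V) : (forall j, lo 0 j <= a 0 j) ->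
  (forall j, gridtop a k 0 j <= hi 0 j) ->
  `|box_int a (gridtop a k) u| <= Bd * vol a (gridtop a k).
Proof.
have [N] := ubnP (\sum_j k j); elim: N => // N IH in k a * => kN loa hik.
have [/forallP k0|/forallPn[i ki]] := boolP [forall j, k j == 0%N].
  have -> : gridtop a k = a + const_mx h.
    by apply/rowP => j; rewrite !mxE (eqP (k0 j)) mul1r.
  have -> : vol a (a + const_mx h) = h ^+ d.
    rewrite volE => [|j]; last by rewrite !mxE lerDl ltW.
    rewrite -[X in _ ^+ X]card_ord -prodr_const; apply: eq_bigr => j _.
    by rewrite !mxE addrAC subrr add0r.
  apply: cubes => // j; have := hik j; rewrite mxE (eqP (k0 j)) mul1r//.
rewrite -lt0n in ki.
pose c := a 0 i + (k i)%:R * h.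
pose k1 j := if j == i then (k i).-1 else k j.
pose k2 j := if j == i then 0%N else k j.
have E1 : upd (gridtop a k) i c = gridtop a k1.
  apply/rowP => j; rewrite !mxE /k1; case: eqP => // ->.
  by rewrite prednK.
have E2 : gridtop a k = gridtop (upd a i c) k2.
  apply/rowP => j; rewrite !mxE /k2; case: eqP => // ->.
  by rewrite /c -natr1; ring.
have ac : a 0 i <= c by rewrite lerDl mulr_ge0// ltW.
have cb : c <= gridtop a k 0 i.
  by rewrite mxE /c lerD2l ler_wpM2r ?ler_nat// ltW.
have acb : a 0 i <= c <= gridtop a k 0 i by rewrite ac cb.
have S1 : (\sum_j k1 j < N)%N.
  rewrite -ltnS; apply: leq_trans kN; rewrite ltnS.
  rewrite (bigD1 i)//= [in X in (_ < X)%N](bigD1 i)//= /k1 eqxx.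
  rewrite (eq_bigr k) => [|j /negbTE ->//].
  by rewrite -addSn prednK.
have S2 : (\sum_j k2 j < N)%N.
  rewrite -ltnS; apply: leq_trans kN; rewrite ltnS.
  rewrite (bigD1 i)//= [in X in (_ < X)%N](bigD1 i)//= /k2 eqxx.
  rewrite (eq_bigr k) => [|j /negbTE ->//].
  by rewrite -addSn leq_add2r.
have Ih : Ig (hbox a (gridtop a k)) u.
  apply: IgS Iu; [exact: lmeas_box|exact: lmeas_hbox|].
  move=> x xh j; have /andP[h1 h2] := xh j.
  by rewrite (le_trans (loa j) (ltW h1)) (le_trans h2 (hik j)).
rewrite (box_int_split acb Ih) (vol_split _ _ i c).
have -> : Num.min (gridtop a k 0 i) c = c by apply/min_idPr.
have -> : Num.max (a 0 i) c = c by apply/max_idPr.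
rewrite mulrDr; apply: le_trans (ler_normD _ _) _; apply: lerD.
  rewrite E1; apply: IH => // j; rewrite -E1 updE; case: eqP => [->|_] //.
  exact: le_trans cb (hik i).
rewrite E2; apply: IH => // j; last by rewrite -E2.
by rewrite updE; case: eqP => [->|_] //; exact: le_trans (loa i) ac.
Qed.

End grid_bound.

(* Changing one coordinate at a time. *)
Lemma path_bound (F : V -> R) (lo hi : V) (L : R) :
  (forall i x t, box lo hi x -> box lo hi (x + t *: evec R i) ->
     `|F (x + t *: evec R i) - F x| <= L * `|t|) ->
  forall x y, box lo hi x -> box lo hi y ->
  `|F y - F x| <= L * \sum_j `|y 0 j - x 0 j|.
Proof.
move=> HF x y xb yb.
pose z (m : nat) : V := \row_j if (j < m)%N then y 0 j else x 0 j.
have zb m : box lo hi (z m).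
  by move=> j; rewrite mxE; case: ifP => _; [exact: yb|exact: xb].
have zy : z d = y by apply/rowP => j; rewrite mxE ltn_ord.
have zx : z 0%N = x by apply/rowP => j; rewrite mxE ltn0.
suff H m : (m <= d)%N -> `|F (z m) - F x| <= L * \sum_(j < d | (j < m)%N) `|y 0 j - x 0 j|.
  have := H d (leqnn _); rewrite zy => /le_trans; apply; rewrite le_eqVlt; apply/orP; left.
  by apply/eqP; congr (_ * _); apply: eq_bigl => j; rewrite ltn_ord.
elim: m => [_|m IH md]; first by rewrite zx subrr normr0 big_pred0// mulr0.
pose i : 'I_d := Ordinal md.
have zE : z m.+1 = z m + (y 0 i - x 0 i) *: evec R i.
  apply/rowP => j; rewrite !mxE eqxx/= ltnS leq_eqVlt.
  rewrite -[(j == m :> nat)]/(j == i); have [->|ji] := eqVneq j i.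
    by rewrite ltnn mulr1 addrC subrK.
  by rewrite mulr0 addr0.
have -> : F (z m.+1) - F x = (F (z m.+1) - F (z m)) + (F (z m) - F x) by ring.
apply: le_trans (ler_normD _ _) _.
rewrite (bigD1 i)//= mulrDr; apply: lerD.
  by rewrite zE; apply: HF => //; rewrite -zE.
rewrite (eq_bigl (fun j : 'I_d => (j < m)%N)); first exact: IH (ltnW md).
move=> j; rewrite ltnS leq_eqVlt -[(j == m :> nat)]/(j == i).
by have [->|ji] := eqVneq j i; rewrite ?ltnn ?andbF//= andbT.
Qed.

End grid.

Lemma cvg_dist_le (R : realType) (u v : nat -> R) (a b c e : R) :
  u @ \oo --> a -> v @ \oo --> b ->
  (\forall k \near \oo, `|u k - v k - c| <= e) -> `|a - b - c| <= e.
Proof.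
move=> ua vb H; apply: (ler_cvg_to _ (cvg_cst e) H).
by apply: cvg_norm; apply: cvgB; [exact: cvgB|exact: cvg_cst].
Qed.

Lemma continuous_of_dist_le (R : realType) (V : normedModType R) (f : V -> R) (x : V) :
  (forall eps, 0 < eps -> \forall y \near x, `|f x - f y| <= eps) -> {for x, continuous f}.
Proof. by move=> H; apply/cvgrPdist_le. Qed.

Lemma dist_le_of_continuous (R : realType) (V : normedModType R) (f : V -> R) (x : V) :
  {for x, continuous f} -> forall eps, 0 < eps -> \forall y \near x, `|f x - f y| <= eps.
Proof. by move=> H; apply/cvgrPdist_le. Qed.

(** * A primitive of the continuous weak gradient *)

Section primitive.
Variables (R : realType) (n : nat).
Local Notation d := n.+1.
Local Notation V := 'rV[R]_d.
Variables (Om : set V) (f : V -> R) (G : 'I_d -> V -> R).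
Hypothesis oOm : open Om.
Hypothesis weak : forall i phi, test_fun Om phi ->
  lint Om (fun x => f x * partial i phi x) = - lint Om (fun x => G i x * phi x).
Hypothesis Gc : forall i x, Om x -> {for x, continuous (G i)}.
Hypothesis If : forall A B, box A B `<=` Om -> Ig (box A B) f.

Definition mesh (m : nat) : R := 2^-1 ^+ m.

Lemma mesh_gt0 m : 0 < mesh m. Proof. by rewrite exprn_gt0// invr_gt0. Qed.

Lemma meshS m : mesh m = 2 * mesh m.+1.
Proof. by rewrite /mesh exprS mulrA mulfV ?mul1r. Qed.

Lemma mesh_le m k : mesh (m + k) <= mesh m.
Proof.
elim: k => [|k IH]; first by rewrite addn0.
by rewrite addnS; apply: le_trans IH; rewrite [leRHS]meshS ler_peMl ?ler1n// ltW// mesh_gt0.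
Qed.

Lemma mesh_cvg0 : mesh @ \oo --> (0 : R).
Proof. by apply: cvg_expr; rewrite ger0_norm ?invr_ge0// invf_lt1 ?ltr1n. Qed.

(** The point is the lower corner of the cube, not its centre: halving the mesh then splits the cube
    into cubes of the same form, one of which keeps the corner [x]. *)
Definition cube_mean m (x : V) : R := box_int x (x + const_mx (mesh m)) f / mesh m ^+ d.

(** Outside [Om] the limit may fail to exist and the value is arbitrary; on [Om] convergence follows
    from [cube_mean_lim]. *)
Definition prim (x : V) : R := lim (cube_mean^~ x @ \oo).

Lemma vol_cube (x : V) (h : R) : 0 <= h -> vol x (x + const_mx h) = h ^+ d.
Proof.
move=> h0; rewrite volE => [|j]; last by rewrite !mxE lerDl.
rewrite -[X in _ ^+ X]card_ord -prodr_const; apply: eq_bigr => j _.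
by rewrite !mxE addrAC subrr add0r.
Qed.

Lemma Ig_bounded_coef A B i (c eps : R) : box A B `<=` Om ->
  (forall y, box A B y -> `|G i y - c| <= eps) -> Ig (box A B) (G i).
Proof.
move=> ABO Gce; apply: (@Ig_bounded _ _ _ _ (`|c| + eps)).
- exact: lmeas_box.
- exact: lout_box_fin.
- by apply: mfS ABO _; [exact: lmeas_open|apply: mf_continuous => //; exact: Gc].
- move=> x /Gce h; rewrite -[G i x](subrK c) addrC.
  by apply: le_trans (ler_normD _ _) _; rewrite lerD2l.
Qed.

(** The margin [rho] keeps cubes with lower corner in the shrunken box inside [box A B]. What
    remains of it, rho - mesh m, is the room that [box_int_increment] requires around its boxes. *)
Lemma cube_mean_incr A B i (c eps rho : R) m (x : V) (t : R) : box A B `<=` Om ->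
  (forall y, box A B y -> `|G i y - c| <= eps) -> mesh m < rho ->
  box A (B - const_mx rho) x -> box A (B - const_mx rho) (x + t *: evec R i) ->
  `|cube_mean m (x + t *: evec R i) - cube_mean m x - t * c| <= `|t| * eps.
Proof.
move=> ABO Gce hr.
have h0 := mesh_gt0 m.
have hd0 : 0 < mesh m ^+ d by rewrite exprn_gt0.
have main (y : V) (s : R) : 0 < s -> box A (B - const_mx rho) y ->
    box A (B - const_mx rho) (y + s *: evec R i) ->
    `|cube_mean m (y + s *: evec R i) - cube_mean m y - s * c| <= s * eps.
  move=> s0 yb yb'.
  have := @box_int_increment R n Om f (G i) i (weak i) A B ABO (If ABO) (Ig_bounded_coef ABO Gce)
    c eps Gce y (y + const_mx (mesh m)) s (rho - mesh m) s0.
  rewrite subr_gt0 hr vol_cube ?(ltW h0)// => /(_ isT) H.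
  have {}H : `|box_int (y + s *: evec R i) (y + const_mx (mesh m) + s *: evec R i) f -
      box_int y (y + const_mx (mesh m)) f - s * c * mesh m ^+ d| <= s * eps * mesh m ^+ d.
    apply: H => j.
    - by have /andP[] := yb j.
    - by rewrite !mxE lerDl ltW.
    - by have := yb' j; rewrite !mxE eqxx/=; lra.
  rewrite /cube_mean (addrAC y).
  set J1 := box_int _ _ f in H *; set J2 := box_int _ _ f in H *.
  have -> : J1 / mesh m ^+ d - J2 / mesh m ^+ d - s * c =
      (J1 - J2 - s * c * mesh m ^+ d) / mesh m ^+ d.
    by field; rewrite gt_eqF.
  by rewrite normrM normfV (gtr0_norm hd0) ler_pdivrMr.
have [t0|t0|<-] := ltgtP 0 t => xb xb'.
- by rewrite (gtr0_norm t0); exact: main.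
(* For negative t the two end points exchange their roles. *)
- have E : x + t *: evec R i + (- t) *: evec R i = x by rewrite scaleNr addrK.
  have := main (x + t *: evec R i) (- t); rewrite E oppr_gt0 => /(_ t0 xb' xb).
  rewrite (ltr0_norm t0) -[X in X <= _]normrN; congr (`|_| <= _); ring.
- by rewrite scale0r addr0 subrr mul0r subr0 normr0 mul0r.
Qed.

Section local.
Variables (A B : V) (L : R).
Hypotheses (ABO : box A B `<=` Om) (L0 : 0 <= L).
Hypothesis GL : forall i y, box A B y -> `|G i y| <= L.

Lemma cube_mean_path m rho x y : mesh m < rho -> box A (B - const_mx rho) x ->
  box A (B - const_mx rho) y -> `|cube_mean m y - cube_mean m x| <= L * \sum_j `|y 0 j - x 0 j|.
Proof.
move=> hr; apply: path_bound => i z t zb zb'.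
have := @cube_mean_incr A B i 0 L rho m z t ABO _ hr zb zb'.
rewrite mulr0 subr0 mulrC; apply => w wb; rewrite subr0; exact: GL.
Qed.

Lemma sum_dist_le (x y : V) (r : R) : (forall j, `|y 0 j - x 0 j| <= r) ->
  \sum_j `|y 0 j - x 0 j| <= d%:R * r.
Proof.
move=> h; apply: le_trans (ler_sum _ (fun j _ => h j)) _.
by rewrite sumr_const card_ord mulr_natl.
Qed.

Lemma box_int_sub_cst (a b : V) (c0 : R) (u : V -> R) : (forall j, a 0 j <= b 0 j) ->
  Ig (hbox a b) u -> box_int a b (fun y => u y - c0) = box_int a b u - c0 * vol a b.
Proof.
move=> ab Iu; rewrite /box_int IntB//; last 2 first.
- exact: lmeas_hbox.
- by apply: Ig_cst; [exact: lmeas_hbox|rewrite lout_hbox// ltry].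
by rewrite (Int_cst _ (@lmeas_hbox _ _ a b)) lout_hbox.
Qed.

(** The large cube splits into cubes of half the side, whose means differ from the mean [c0] at the
    corner [x] by at most L times the distance of the corners. [grid_bound] for f - c0 averages
    these differences. *)
Lemma cube_mean_step m rho x : mesh m < rho -> box A (B - const_mx rho) x ->
  `|cube_mean m x - cube_mean m.+1 x| <= L * d%:R * mesh m.
Proof.
move=> hr xb; pose c0 := cube_mean m.+1 x.
have h0 := mesh_gt0 m.+1; have E := meshS m.
have H0 := mesh_gt0 m.
pose hi : V := x + const_mx (mesh m).
have subAB : box x hi `<=` box A B.
  by move=> y yb j; have := yb j; have := xb j; rewrite !mxE; lra.
have Ix : Ig (box x hi) f by apply: IgS (If ABO); [exact: lmeas_box|exact: lmeas_box|].
have Iu : Ig (box x hi) (fun y => f y - c0).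
  apply: IgB => //; first exact: lmeas_box.
  by apply: Ig_cst; [exact: lmeas_box|exact: lout_box_fin].
have xhi j : x 0 j <= hi 0 j by rewrite !mxE lerDl ltW.
have Ihb (a b : V) : (forall j, x 0 j <= a 0 j) -> (forall j, b 0 j <= hi 0 j) -> Ig (hbox a b) f.
  move=> xa bh; apply: IgS Ix; [exact: lmeas_box|exact: lmeas_hbox|].
  move=> y yb j; have /andP[h1 h2] := yb j.
  by rewrite (le_trans (xa j) (ltW h1)) (le_trans h2 (bh j)).
have cubes (a : V) : (forall j, x 0 j <= a 0 j) -> (forall j, a 0 j + mesh m.+1 <= hi 0 j) ->
    `|box_int a (a + const_mx (mesh m.+1)) (fun y => f y - c0)| <=
      (L * d%:R * mesh m) * mesh m.+1 ^+ d.
  move=> xa ahi.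
  have aa j : a 0 j <= (a + const_mx (mesh m.+1)) 0 j by rewrite !mxE lerDl ltW.
  rewrite box_int_sub_cst//; last first.
    by apply: Ihb => // j; have := ahi j; rewrite !mxE.
  rewrite vol_cube ?(ltW h0)//.
  have hd0 : 0 < mesh m.+1 ^+ d by rewrite exprn_gt0.
  have -> : box_int a (a + const_mx (mesh m.+1)) f - c0 * mesh m.+1 ^+ d =
      (cube_mean m.+1 a - cube_mean m.+1 x) * mesh m.+1 ^+ d.
    have MA : cube_mean m.+1 a * mesh m.+1 ^+ d = box_int a (a + const_mx (mesh m.+1)) f.
      by rewrite /cube_mean divfK ?gt_eqF.
    by rewrite mulrBl MA.
  rewrite normrM (gtr0_norm hd0) ler_wpM2r ?(ltW hd0)//.
  (* The corners of the small cubes may leave the box with margin rho. They keep the smaller margin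
     rho - mesh m + mesh m.+1, which still exceeds the side of a small cube. *)
  have hr' : mesh m.+1 < rho - mesh m + mesh m.+1 by rewrite ltrDr subr_gt0.
  apply: (@le_trans _ _ (L * \sum_j `|a 0 j - x 0 j|)).
    apply: (cube_mean_path hr') => j.
      by have := xb j; rewrite !mxE; lra.
    by have := ahi j; have := xa j; have := xb j; rewrite !mxE; lra.
  rewrite -mulrA ler_wpM2l//; apply: sum_dist_le => j.
  by have := ahi j; have := xa j; rewrite ler_norml !mxE; lra.
have top : gridtop (mesh m.+1) x (fun=> 1%N) = hi.
  by apply/rowP => j; rewrite !mxE -E.
have := @grid_bound R n (fun y => f y - c0) x hi (mesh m.+1)
  (L * d%:R * mesh m) h0 Iu cubes (fun=> 1%N) x.
rewrite top => /(_ (fun j => lexx _) (fun j => lexx _)).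
rewrite box_int_sub_cst//; last exact: Ihb.
rewrite vol_cube ?(ltW H0)//.
have Hd0 : 0 < mesh m ^+ d by rewrite exprn_gt0.
have -> : box_int x hi f - c0 * mesh m ^+ d = (cube_mean m x - c0) * mesh m ^+ d.
  have MX : cube_mean m x * mesh m ^+ d = box_int x hi f by rewrite /cube_mean divfK ?gt_eqF.
  by rewrite mulrBl MX.
by rewrite normrM (gtr0_norm Hd0) ler_pM2r.
Qed.

(** As C mesh_m = 2 C (mesh_m - mesh_(m+1)), the bound on one step makes [v] minus 2 C mesh
    nondecreasing and [v] plus 2 C mesh nonincreasing. These monotone sequences squeeze [v], and
    their first terms give the error bound. *)
Lemma cube_mean_lim m rho x : mesh m < rho -> box A (B - const_mx rho) x ->
  cube_mean^~ x @ \oo --> prim x /\ `|cube_mean m x - prim x| <= 2 * (L * d%:R) * mesh m.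
Proof.
move=> hr xb; set C := L * d%:R.
have C0 : 0 <= C by rewrite mulr_ge0.
pose v k := cube_mean (m + k) x.
have step k : `|v k - v k.+1| <= C * mesh (m + k).
  by rewrite /v addnS; apply: (@cube_mean_step _ rho) => //; exact: le_lt_trans (mesh_le m k) hr.
pose dn k := v k - 2 * C * mesh (m + k).
pose up k := v k + 2 * C * mesh (m + k).
have dnS k : dn k <= dn k.+1.
  have := step k; rewrite /dn addnS (meshS (m + k)) ler_norml.
  by have := mesh_gt0 (m + k).+1; move: (mesh _) (v k) (v k.+1) => z a b; nra.
have upS k : up k.+1 <= up k.
  have := step k; rewrite /up addnS (meshS (m + k)) ler_norml.
  by have := mesh_gt0 (m + k).+1; move: (mesh _) (v k) (v k.+1) => z a b; nra.
have dn_homo : nondecreasing_seq dn by apply/nondecreasing_seqP.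
have up0 k : dn k <= up 0%N.
  apply: (@le_trans _ _ (up k)).
    have := mulr_ge0 C0 (ltW (mesh_gt0 (m + k))).
    by rewrite /dn /up -!mulrA; lra.
  by elim: k => // k IH; exact: le_trans (upS k) IH.
have dnc : cvgn dn.
  by apply: nondecreasing_is_cvgn => //; exists (up 0%N) => _ [k _ <-].
have hc : (fun k => 2 * C * mesh (m + k)) @ \oo --> (0 : R).
  rewrite -[X in _ --> X](mulr0 (2 * C)); apply: cvgM; first exact: cvg_cst.
  by have := mesh_cvg0; rewrite -(cvg_shiftn m); under eq_fun do rewrite addnC.
have vc : v @ \oo --> limn dn.
  have -> : v = (fun k => dn k + 2 * C * mesh (m + k)).
    by apply/funext => k; rewrite /dn subrK.
  by rewrite -[X in _ --> X]addr0; apply: cvgD.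
have Mc : cube_mean^~ x @ \oo --> limn dn.
  by rewrite -(cvg_shiftn m); under eq_fun do rewrite addnC.
have glE : prim x = limn dn by exact: cvg_lim Mc.
split; first by rewrite glE.
rewrite glE; have l1 : dn 0%N <= limn dn by exact: nondecreasing_cvgn_le.
have l2 : limn dn <= up 0%N by apply: limr_le => //; exact: nearW.
by move: l1 l2; rewrite /dn /up /v addn0 ler_norml; lra.
Qed.

Lemma near_mesh_lt rho : 0 < rho -> exists m, forall k, (m <= k)%N -> mesh k < rho.
Proof.
move=> r0; have [m _ H] := cvgr_lt (0 : R) mesh_cvg0 _ r0.
by exists m => k mk; exact: H.
Qed.

Lemma prim_incr i (c eps rho : R) x t : 0 < rho ->
  (forall y, box A B y -> `|G i y - c| <= eps) ->
  box A (B - const_mx rho) x -> box A (B - const_mx rho) (x + t *: evec R i) ->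
  `|prim (x + t *: evec R i) - prim x - t * c| <= `|t| * eps.
Proof.
move=> r0 Gce xb xb'; have [m hmr] := near_mesh_lt r0.
have [c1 _] := cube_mean_lim (hmr m (leqnn m)) xb.
have [c2 _] := cube_mean_lim (hmr m (leqnn m)) xb'.
apply: (cvg_dist_le c2 c1).
by exists m => // k /hmr hk; apply: (@cube_mean_incr A B i c eps rho).
Qed.

Lemma prim_path rho x y : 0 < rho -> box A (B - const_mx rho) x ->
  box A (B - const_mx rho) y -> `|prim y - prim x| <= L * \sum_j `|y 0 j - x 0 j|.
Proof.
move=> r0; apply: path_bound => i z t zb zb'.
have := @prim_incr i 0 L rho z t r0 _ zb zb'.
rewrite mulr0 subr0 mulrC; apply => w wb; rewrite subr0; exact: GL.
Qed.

End local.

Lemma local_box x (eps : R) : Om x -> 0 < eps -> exists r L, [/\ 0 < r, 0 <= L,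
  boxc x r `<=` Om, (forall i y, boxc x r y -> `|G i y - G i x| <= eps) &
  (forall i y, boxc x r y -> `|G i y| <= L)].
Proof.
move=> Dx e0.
have : nbhs x [set y | Om y /\ forall i, `|G i y - G i x| <= eps].
  apply: filterI; first exact: open_nbhs_nbhs.
  apply: (@filter_forall _ _ (fun i y => `|G i y - G i x| <= eps) (nbhs x)) => i.
  have := dist_le_of_continuous (@Gc i x Dx) e0.
  by apply: filterS => y; rewrite distrC.
move=> /nbhs_boxc[r r0 hr].
exists r, (\sum_i `|G i x| + eps); split => //.
- by rewrite addr_ge0 ?sumr_ge0// ltW.
- by move=> y /hr[].
- by move=> i y /hr[_]; exact.
- move=> i y /hr[_ /(_ i) h].
  rewrite -[G i y](subrK (G i x)) addrC; apply: le_trans (ler_normD _ _) _.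
  by apply: lerD => //; rewrite (bigD1 i)//= lerDl sumr_ge0.
Qed.

Lemma boxc_half (x y : V) (r : R) : (forall j, `|y 0 j - x 0 j| <= r / 2) ->
  box (x - const_mx r) (x + const_mx r - const_mx (r / 2)) y.
Proof. by move=> h j; have := h j; rewrite ler_norml !mxE; lra. Qed.

(** [prim_incr] with c = G i x bounds the error of the difference quotient by the oscillation of G i
    near x, which continuity makes small. *)
Lemma is_derive_prim i x : Om x -> is_derive x (evec R i) prim (G i x).
Proof.
move=> Dx; apply: is_derive_cvg; apply/cvgrPdist_le => eps e0.
have [r [L [r0 L0 rO GE GL]]] := local_box Dx e0.
have : \forall h \near (0:R)^', `|h| <= r / 2 by apply: dnbhs0_le; rewrite divr_gt0.
have : \forall h \near (0:R)^', h != 0 by exact: nbhs_dnbhs_neq.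
apply: filterS2 => h h0 hr.
have xb : box (x - const_mx r) (x + const_mx r - const_mx (r / 2)) x.
  by apply: boxc_half => j; rewrite subrr normr0 divr_ge0// ltW.
have xb' : box (x - const_mx r) (x + const_mx r - const_mx (r / 2)) (x + h *: evec R i).
  apply: boxc_half => j; rewrite !mxE eqxx/= addrAC subrr add0r.
  by case: (j == i); rewrite ?mulr1 ?mulr0 ?normr0// divr_ge0// ltW.
have r2 : 0 < r / 2 by rewrite divr_gt0.
have := @prim_incr (x - const_mx r) (x + const_mx r) L rO L0 GL i
  (G i x) eps (r / 2) x h r2 (GE i) xb xb'.
rewrite (addrC x) => H.
have -> : G i x - h^-1 * (prim (h *: evec R i + x) - prim x) =
    - (h^-1 * (prim (h *: evec R i + x) - prim x - h * G i x)).
  by rewrite [in RHS]mulrBr (mulKf h0) opprB.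
by rewrite normrN normrM normfV ler_pdivrMl ?normr_gt0.
Qed.

Lemma continuous_prim x : Om x -> {for x, continuous prim}.
Proof.
move=> Dx; have [r [L [r0 L0 rO _ GL]]] := local_box Dx (@ltr01 R).
apply: continuous_of_dist_le => eps e0.
pose K := L * d%:R + 1; have K0 : 0 < K by rewrite ltr_wpDl// mulr_ge0.
pose r' := Num.min (r / 2) (eps / K).
have r'0 : 0 < r' by rewrite lt_min !divr_gt0.
apply: filterS (boxc_nbhs x r'0) => y /boxcP xy.
have r2 : 0 < r / 2 by rewrite divr_gt0.
have xb : box (x - const_mx r) (x + const_mx r - const_mx (r / 2)) x.
  by apply: boxc_half => j; rewrite subrr normr0 ltW.
have yb : box (x - const_mx r) (x + const_mx r - const_mx (r / 2)) y.
  by apply: boxc_half => j; apply: le_trans (xy j) _; rewrite ge_min lexx.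
rewrite distrC; apply: le_trans (prim_path rO L0 GL r2 xb yb) _.
apply: (@le_trans _ _ (L * (d%:R * r'))).
  by rewrite ler_wpM2l//; exact: sum_dist_le.
rewrite mulrA; apply: (@le_trans _ _ (K * r')).
  by rewrite ler_wpM2r ?(ltW r'0)// lerDl.
by rewrite mulrC -ler_pdivlMr// ge_min lexx orbT.
Qed.

Lemma smooth_prim : (forall i, smooth_on Om (G i)) -> smooth_on Om prim.
Proof.
move=> GS; apply/smooth_onP => m; apply: CnW.
apply: (@Cn_succ _ _ _ oOm m prim G).
- by move=> x Dx; exact: continuous_prim.
- by move=> i x Dx; exact: is_derive_prim.
- by move=> i; have /smooth_onP := GS i; exact.
Qed.

Lemma mf_prim D : lmeas D -> D `<=` Om -> mf D prim.
Proof.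
move=> mD DO; apply: (mfS (lmeas_open oOm) DO); apply: mf_continuous => // x.
exact: continuous_prim.
Qed.

Section ae_local.
Variables (A B : V) (L rho : R).
Hypotheses (ABO : box A B `<=` Om) (L0 : 0 <= L) (r0 : 0 < rho).
Hypothesis GL : forall i y, box A B y -> `|G i y| <= L.
Let hi := B - const_mx rho.
Let u x := f x - prim x.

Let hi_sub : box A hi `<=` box A B.
Proof. by move=> x xh j; have := xh j; have := r0; rewrite !mxE; lra. Qed.

Let hbox_sub (a b : V) : (forall j, A 0 j <= a 0 j) -> (forall j, b 0 j <= hi 0 j) ->
  hbox a b `<=` box A hi.
Proof.
move=> Aa bh x xab j; have /andP[h1 h2] := xab j.
by rewrite (le_trans (Aa j) (ltW h1)) (le_trans h2 (bh j)).
Qed.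

Let mh : lmeas (box A hi). Proof. exact: lmeas_box. Qed.

Lemma Ig_prim : Ig (box A hi) prim.
Proof.
apply: (@Ig_bounded _ _ _ _ (`|prim A| + L * \sum_j `|hi 0 j - A 0 j|)) => //.
- exact: lout_box_fin.
- by apply: mf_prim => // x /hi_sub/ABO.
- move=> y yb; have Ab : box A hi A.
    by move=> j; have /andP[h1 h2] := yb j; rewrite lexx (le_trans h1 h2).
  rewrite -[prim y](subrK (prim A)) addrC; apply: le_trans (ler_normD _ _) _.
  rewrite lerD2l; apply: le_trans (prim_path ABO L0 GL r0 Ab yb) _.
  rewrite ler_wpM2l//; apply: ler_sum => j _; have /andP[h1 h2] := yb j.
  by rewrite !ger0_norm ?subr_ge0// ?lerD2r// (le_trans h1 h2).
Qed.

Let If' : Ig (box A hi) f.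
Proof. by apply: IgS (If ABO) => //; exact: lmeas_box. Qed.

Let Iu : Ig (box A hi) u. Proof. exact: IgB mh If' Ig_prim. Qed.

(** The constant 3 is 2 + 1: twice L d mesh bounds the distance from the mean of f to [prim a], and
    once bounds the oscillation of [prim] on the cube. The extra factor [mesh m] makes the sum over
    a grid tend to 0. *)
Lemma box_int_cube m (a : V) : mesh m < rho -> (forall j, A 0 j <= a 0 j) ->
  (forall j, a 0 j + mesh m <= hi 0 j) ->
  `|box_int a (a + const_mx (mesh m)) u| <= 3 * (L * d%:R) * mesh m * mesh m ^+ d.
Proof.
move=> hr Aa ah; have h0 := mesh_gt0 m; have hd0 : 0 < mesh m ^+ d by rewrite exprn_gt0.
set b := a + const_mx (mesh m).
have ab j : a 0 j <= b 0 j by rewrite !mxE lerDl ltW.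
have bh j : b 0 j <= hi 0 j by rewrite !mxE; have := ah j; rewrite !mxE.
have near_a x : hbox a b x -> forall j, `|x 0 j - a 0 j| <= mesh m.
  by move=> xab j; have := xab j; rewrite !mxE ler_norml; lra.
have sub := hbox_sub Aa bh.
have mb := @lmeas_hbox _ _ a b.
have Ifb : Ig (hbox a b) f by exact: IgS If'.
have Igb : Ig (hbox a b) prim by apply: IgS Ig_prim.
have vE : vol a b = mesh m ^+ d by rewrite vol_cube// ltW.
have ha : box A hi a by move=> j; rewrite Aa/= (le_trans (ab j)).
have fE : box_int a b f = cube_mean m a * mesh m ^+ d by rewrite /cube_mean divfK ?gt_eqF.
have gE : box_int a b (fun x => prim x - prim a) = box_int a b prim - prim a * mesh m ^+ d.
  by have := box_int_sub_cst (prim a) ab Igb; rewrite vE.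
have dE : box_int a b u = box_int a b f - box_int a b prim := IntB mb Ifb Igb.
have alg (p q s z w v y : R) : w = v - q -> v = p * s -> y = q - z * s ->
    w = (p - z) * s - y by move=> -> -> ->; ring.
have uE := alg _ _ _ _ _ _ _ dE fE gE.
have [_ h1] := cube_mean_lim ABO L0 GL hr ha.
have h2 : `|box_int a b (fun x => prim x - prim a)| <= L * d%:R * mesh m * mesh m ^+ d.
  have fin : (lout (hbox a b) < +oo)%E by rewrite lout_hbox// ltry.
  have <- : Int (hbox a b) (fun=> L * d%:R * mesh m) = L * d%:R * mesh m * mesh m ^+ d.
    by rewrite (Int_cst _ mb) lout_hbox// vE.
  have Ic z : Ig (hbox a b) (fun=> z) := Ig_cst z mb fin.
  have Ik : Ig (hbox a b) (fun x => prim x - prim a) := IgB mb Igb (Ic (prim a)).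
  have kle x : hbox a b x -> `|prim x - prim a| <= L * d%:R * mesh m.
    move=> xab; apply: le_trans (prim_path ABO L0 GL r0 ha (sub x xab)) _.
    rewrite -mulrA ler_wpM2l//; apply: sum_dist_le; exact: near_a.
  exact: (Int_abs_le mb Ik (Ic _) kle).
rewrite uE; apply: le_trans (ler_normB _ _) _.
have h3 : `|(cube_mean m a - prim a) * mesh m ^+ d| <= 2 * (L * d%:R) * mesh m * mesh m ^+ d.
  by rewrite normrM (gtr0_norm hd0) ler_pM2r.
apply: le_trans (lerD h3 h2) _; rewrite le_eqVlt; apply/orP; left; apply/eqP; ring.
Qed.

(* The grid of mesh [mesh m] based at [a] that just covers [hbox a b]. *)
Let top (a b : V) m : V := gridtop (mesh m) a (fun j => Num.trunc ((b 0 j - a 0 j) / mesh m)).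

Let top_bounds (a b : V) m j : a 0 j <= b 0 j ->
  b 0 j < top a b m 0 j /\ top a b m 0 j <= b 0 j + mesh m.
Proof.
move=> ab; have h0 := mesh_gt0 m.
have q0 : 0 <= (b 0 j - a 0 j) / mesh m by rewrite divr_ge0 ?subr_ge0// ltW.
have /andP[t1 t2] := truncn_itv q0; rewrite mxE -natr1.
move: t1 t2; rewrite -natr1 ler_pdivlMr// ltr_pdivrMr//.
by move: (_%:R) => t t1 t2; split; lra.
Qed.

(** A grid of cubes that slightly overshoots the box has at most a fixed total volume, so by
    [box_int_cube] the integral over it is O(mesh m). The margin [rho] accommodates the
    overshoot. *)
Lemma box_int_box0 (a b : V) : (forall j, A 0 j <= a 0 j) -> (forall j, a 0 j <= b 0 j) ->
  (forall j, b 0 j + rho <= hi 0 j) -> box_int a b u = 0.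
Proof.
move=> Aa ab bh; have [m0 m0P] := near_mesh_lt r0.
have bhi j : b 0 j <= hi 0 j by apply: le_trans (bh j); rewrite lerDl ltW.
pose C := 3 * (L * d%:R) * vol A hi.
(* The integral over the overshooting grid. Its tops tend to [b] from above, and half-open boxes
   contain their upper faces, so the indicators converge at every point, those of the faces
   included. *)
pose w m := Int (box A hi) (fun x => if x \in hbox a (top a b m) then u x else 0).
have topge m j : a 0 j <= top a b m 0 j.
  by apply: le_trans (ab j) (ltW _); have [] := top_bounds m (ab j).
have tophi m j : (m0 <= m)%N -> top a b m 0 j <= hi 0 j.
  move=> mm; have [_ h] := top_bounds m (ab j); apply: le_trans h (le_trans _ (bh j)).
  by rewrite lerD2l ltW// m0P.
have wle m : (m0 <= m)%N -> `|w m| <= C * mesh m.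
  move=> mm; have h0 := mesh_gt0 m.
  rewrite /w Int_restrict; last by apply: hbox_sub => // j; exact: tophi.
  have cub (z : V) : (forall j, A 0 j <= z 0 j) -> (forall j, z 0 j + mesh m <= hi 0 j) ->
      `|box_int z (z + const_mx (mesh m)) u| <= 3 * (L * d%:R) * mesh m * mesh m ^+ d.
    by apply: box_int_cube; exact: m0P.
  have := @grid_bound R n u A hi (mesh m) (3 * (L * d%:R) * mesh m) h0 Iu cub
    (fun j => Num.trunc ((b 0 j - a 0 j) / mesh m)) a Aa (fun j => tophi m j mm).
  move=> /le_trans; apply; rewrite /C mulrAC ler_wpM2r ?(ltW h0)//.
  rewrite ler_wpM2l ?mulr_ge0// volE; last exact: topge.
  rewrite volE => [|j]; last by rewrite (le_trans (Aa j)) ?(le_trans (ab j)).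
  apply: ler_prod => j _; rewrite subr_ge0 topge/=; apply: lerB; [exact: tophi|exact: Aa].
have mtop m : lmeas (hbox a (top a b m)) by exact: lmeas_hbox.
have mab : lmeas (hbox a b) by exact: lmeas_hbox.
have wc : w @ \oo --> box_int a b u.
  rewrite /box_int -(Int_restrict _ (hbox_sub Aa bhi)).
  apply: (@Int_dct _ _ _ _ u) => //.
  - exact: Ig_ind.
  - by move=> m; apply: Ig_mf; exact: Ig_ind.
  - by move=> m x _; case: ifP => // _; rewrite normr0.
  - move=> x _; apply: cvg_near_cst.
    have [xab|nxab] := pselect (hbox a b x).
      apply: nearW => m; rewrite !mem_set// => j; have /andP[h1 h2] := xab j.
      by rewrite h1/= (le_trans h2)// ltW//; have [] := top_bounds m (ab j).
    rewrite (memNset nxab).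
    have [j] : exists j, ~ (a 0 j < x 0 j <= b 0 j) by apply/existsNP.
    have [ax|xa] := ltP (a 0 j) (x 0 j) => /=; last first.
      move=> _; apply: nearW => m; rewrite memNset// => /(_ j) /andP[].
      by rewrite ltNge xa.
    move/negP; rewrite -ltNge -subr_gt0 => /near_mesh_lt[m1 m1P].
    exists m1 => // m /m1P hm1 /=; rewrite memNset// => /(_ j) /andP[_].
    by have [_] := top_bounds m (ab j); lra.
have C0 : (fun m => C * mesh m) @ \oo --> (0 : R).
  by rewrite -[X in _ --> X](mulr0 C); apply: cvgM; [exact: cvg_cst|exact: mesh_cvg0].
have H : `|box_int a b u| <= 0.
  by apply: (ler_cvg_to (cvg_norm wc) C0); exists m0 => // m; exact: wle.
by apply/eqP; rewrite -normr_eq0 eq_le H normr_ge0.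
Qed.

Lemma ae_prim_local : lout [set x | box A (hi - const_mx rho) x /\ u x <> 0] = 0%E.
Proof.
apply: ae_zero_of_box_int0.
  apply: IgS Iu => //; first exact: lmeas_box.
  by move=> x xb j; have := xb j; have := r0; rewrite !mxE; lra.
move=> a b Aa ab bh; apply: box_int_box0 => // j.
by have := bh j; rewrite !mxE; lra.
Qed.

End ae_local.

Lemma ae_prim : ae_on Om (fun x => f x = prim x).
Proof.
rewrite /ae_on (_ : [set x | _] = Om `&` [set x | f x <> prim x])//.
apply: lout_local => // x Dx.
have [r [L [r0 L0 rO _ GL]]] := local_box Dx (@ltr01 R).
(* The margin is spent twice at the upper end, once for the cubes defining [prim] and once for the
   overshoot of the grid: r - 2 (r / 4) = r / 2. *)
have r4 : 0 < r / 4 by rewrite divr_gt0.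
have r2 : 0 < r / 2 by rewrite divr_gt0.
exists (boxc x (r / 2)); first exact: boxc_nbhs.
apply/eqP; rewrite eq_le lout_ge0 andbT.
rewrite -(@ae_prim_local (x - const_mx r) (x + const_mx r) L (r / 4) rO L0 r4 GL).
apply: le_lout => y [yb ney]; split.
  by move=> j; have := yb j; rewrite !mxE; lra.
by move=> /eqP; rewrite subr_eq0 => /eqP.
Qed.

End primitive.

(** * Almost-everywhere statements *)

Section almost_everywhere.
Variables (R : realType) (n : nat).
Local Notation d := n.+1.
Local Notation V := 'rV[R]_d.
Implicit Types (D : set V) (P Q : V -> Prop).

Lemma ae_on_imp D P Q : (forall x, D x -> P x -> Q x) -> ae_on D P -> ae_on D Q.
Proof.
move=> PQ P0; apply/eqP; rewrite eq_le lout_ge0 andbT -P0; apply: le_lout.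
by move=> x [Dx nQ]; split => // /(PQ x Dx).
Qed.

Lemma ae_on_and D P Q : ae_on D P -> ae_on D Q -> ae_on D (fun x => P x /\ Q x).
Proof.
move=> P0 Q0; apply/eqP; rewrite eq_le lout_ge0 andbT.
rewrite -[leRHS]adde0 -{1}P0 -Q0.
apply: le_trans (@outer_measureU2 _ _ (@lout R d) _ _); apply: le_lout => x [Dx nPQ].
have [Px|nPx] := pselect (P x); [right|left]; split => // Qx; exact: nPQ.
Qed.

Lemma ae_on_forall D (P : 'I_d -> V -> Prop) :
  (forall i, ae_on D (P i)) -> ae_on D (fun x => forall i, P i x).
Proof.
move=> P0.
have H (s : seq 'I_d) : ae_on D (fun x => forall i, i \in s -> P i x).
  elim: s => [|i s IH].
    apply/eqP; rewrite eq_le lout_ge0 andbT -(@lout0 R n); apply: le_lout.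
    by move=> x [_]; apply.
  apply: ae_on_imp (ae_on_and (P0 i) IH) => x _ [Pi Ps] j.
  by rewrite inE => /orP[/eqP->|/Ps].
by apply: ae_on_imp (H (enum 'I_d)) => x _ Px i; apply: Px; rewrite mem_enum.
Qed.

(** Where the two differ, they differ on a neighbourhood, and nonempty open sets are not null. *)
Lemma eq_of_ae_continuous D (f g : V -> R) : open D -> ae_on D (fun x => f x = g x) ->
  (forall x, D x -> {for x, continuous f}) -> (forall x, D x -> {for x, continuous g}) ->
  forall x, D x -> f x = g x.
Proof.
move=> oD fg fc gc x Dx; apply/eqP; rewrite -subr_eq0; apply/negPn/negP => ne.
have c : {for x, continuous (fun y => f y - g y)}.
  exact: (cvgB (fc x Dx : f @ x --> f x) (gc x Dx : g @ x --> g x)).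
have nA := continuous_near_neq0 c ne.
have [y [/= ny _ e]] := ae_dense oD fg Dx nA.
by move: ny; rewrite e subrr eqxx.
Qed.

End almost_everywhere.

(** * Smoothness of f *)

Theorem mainTheorem15 (R : realType) (d k : nat) (Omega : set 'rV[R]_d)
    (p : R) (f : 'rV[R]_d -> 'rV[R]_d) (Df : 'rV[R]_d -> 'M[R]_d) :
  (2 < d)%N -> open Omega -> (2 <= k <= d - 1)%N -> 1 <= p ->
  sobolev_jac p Omega f Df ->
  (ae_on Omega (fun x => 0 < \det (Df x)) \/
   ae_on Omega (fun x => \det (Df x) < 0)) ->
  (exists W : 'rV[R]_d -> 'M[R]_#|{: ksub d k}|,
      (forall I J, smooth_on Omega (fun x => W x I J)) /\
      (forall x, Omega x -> W x \in unitmx) /\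
      ae_on Omega (fun x => W x = extpow k (Df x))) ->
  (exists G : 'rV[R]_d -> 'M[R]_d,
      (forall x, Omega x -> {for x, continuous G}) /\
      ae_on Omega (fun x => G x = Df x)) ->
  exists g : 'rV[R]_d -> 'rV[R]_d,
    (forall j, smooth_on Omega (fun x => g x 0 j)) /\
    ae_on Omega (fun x => f x = g x).
Proof.
case: d Omega f Df => // n Omega f Df _ oO /andP[k2 kd] p1 [fLp [_ weak]] _.
move=> [W [Ws [Wu WD]]] [G [Gc GD]].
have Gcij i j x : Omega x -> {for x, continuous (fun y => G y i j)}.
  by move=> Dx; exact: continuous_entry (Gc x Dx).
have GC : mxCn 0 Omega G by move=> i j; split => // x Dx; exact: Gcij.
(* The smooth representative and the exterior power of G agree almost everywhere and are both
   continuous, so they agree at every point of the domain; the algebraic argument needs this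
   pointwise identity. *)
have WG x : Omega x -> W x = extpow k (G x).
  move=> Dx; apply/matrixP => I J.
  apply: (@eq_of_ae_continuous _ _ Omega (fun y => W y I J) (fun y => extpow k (G y) I J)) => //.
  - apply: ae_on_imp (ae_on_and WD GD) => y _ [-> ->] //.
  - by move=> y Dy; have [_] := Ws I J [::] y Dy.
  - move=> y Dy; apply: (@Cn_cont _ _ 0 Omega (fun y => extpow k (G y) I J)) => //.
    apply: (@Cn_eq _ _ _ oO 0 (fun x => \det (\matrix_(a < k, b < k)
      G x (kidx (enum_val I) a) (kidx (enum_val J) b)))).
      by move=> z _; rewrite mxE.
    apply: (Cn_det oO) => a b; apply: (Cn_eq oO _ (GC _ _)) => z _.
    by rewrite mxE.
have kn : (0 < k <= n.+1.-1)%N by rewrite (ltnW k2) -subn1.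
have GS := smooth_extpow_root oO kn Gc Ws Wu WG.
have If j A B : box A B `<=` Omega -> Ig (box A B) (fun x => f x 0 j).
  move=> AB; apply: (Lp_integrable p1 (lmeas_open oO) (fLp j)) => //.
    exact: lmeas_box.
  exact: lout_box_fin.
(* The weak gradient enters only through integrals, so its continuous representative may take its
   place. *)
have wk j i phi : test_fun Omega phi ->
    lint Omega (fun x => f x 0 j * partial i phi x) =
    - lint Omega (fun x => G x j i * phi x).
  move=> tphi.
  have E : lint Omega (fun x => Df x j i * phi x) = lint Omega (fun x => G x j i * phi x).
    by apply: lint_ae; apply: ae_on_imp GD => x _ ->.
  by rewrite -E; exact: weak.
pose g j := prim (fun x => f x 0 j).
exists (fun x => \row_j g j x); split.
  move=> j; rewrite (_ : (fun x => _) = g j); last by apply/funext => x; rewrite mxE.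
  exact: (smooth_prim oO (wk j) (Gcij j) (If j) (GS j)).
have aej j := ae_prim oO (wk j) (Gcij j) (If j).
apply: ae_on_imp (ae_on_forall aej) => x _ e; apply/rowP => j.
by rewrite e mxE.
Qed.
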